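(* Let $E$ be one of the Korenblum type spaces $E=A_+^{-\gamma}$ with $\gamma\ge0$, or $E=A_-^{-\gamma}$ with $0<\gamma\le\infty$. Then the integration operator $J$, $Jf(z)=\int_0^zf(\zeta)\,d\zeta$, is continuous on $E$, and every proper closed invariant subspace of $J$ on $E$ is of the form $$A^E_K=\{f\in E \mid f^{(j)}(0)=0,\ 0\le j<K\}$$ for some $K\in\mathbb{N}$.
   Context: $\mathbb{N}=\{1,2,3,\dots\}$; $\mathbb{D}$ is the open unit disc in $\mathbb{C}$ and $H(\mathbb{D})$ the space of holomorphic functions on it. For $\mu>0$, $A^{-\mu}$ is the Banach space of all $f\in H(\mathbb{D})$ with $\sup_{z\in\mathbb{D}}(1-|z|)^\mu|f(z)|<\infty$, normed by this supremum. For $\gamma\ge0$, $A_+^{-\gamma}:=\bigcap_{\mu>\gamma}A^{-\mu}$, a Fréchet space with the topology generated by the increasing sequence of norms $f\mapsto\sup_{z\in\mathbb{D}}(1-|z|)^{\gamma+1/k}|f(z)|$, $k\in\mathbb{N}$. For $0<\gamma\le\infty$, $A_-^{-\gamma}:=\bigcup_{0<\mu<\gamma}A^{-\mu}$, endowed with the finest locally convex topology such that all the inclusions $A^{-\mu}\subset A_-^{-\gamma}$, $0<\mu<\gamma$, are continuous; it is an (LB)-space (a countable inductive limit of Banach spaces). The case $\gamma=\infty$ is the Korenblum space $A^{-\infty}=\mathrm{ind}_n A^{-n}$. A subspace $M$ of a locally convex space $E$ is proper if $\{0\}\ne M\ne E$, and is invariant for a continuous linear operator $T:E\to E$ if $T(M)\subset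 M$. *)

(* Defs.v *)
From HB Require Import structures.
From mathcomp Require Import all_boot all_order all_algebra.
From mathcomp Require Import all_classical all_reals all_analysis.
From mathcomp.real_closed Require Import complex.

Set Implicit Arguments.
Unset Strict Implicit.
Unset Printing Implicit Defensive.

Import Order.TTheory GRing.Theory Num.Theory.
Import numFieldNormedType.Exports.

Local Open Scope classical_set_scope.
Local Open Scope ring_scope.
Local Open Scope complex_scope.

Section growth_spaces.
Variable R : realType.
Local Notation C := R[i].

(* Real-valued modulus; in R[i] the norm `|z| is itself a complex number. *)
Definition cabs (z : C) : R := complex.Re `|z|.

Definition unit_disc : set C := [set z | cabs z < 1].

(* A function on the disc is represented by its extension by 0 to the whole
   plane, so that Leibniz equality is equality on the disc. *)
Definition holomorphic : set (C -> C^o) :=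
  [set f | (forall z, unit_disc z -> @derivable C C^o C^o f z 1) /\
           (forall z, ~ unit_disc z -> f z = 0)].

Definition growth_norm (mu : R) (f : C -> C^o) : \bar R :=
  ereal_sup [set ((1 - cabs z) `^ mu * cabs (f z))%:E | z in unit_disc].

Definition growth_space (mu : R) : set (C -> C^o) :=
  [set f | holomorphic f /\ (growth_norm mu f < +oo)%E].

(* The integral from 0 to z is taken along the segment t |-> t z. *)
Definition integration (f : C -> C^o) : C -> C^o := fun z =>
  if cabs z < 1 then
    z * ((\int[lebesgue_measure]_(t in `[0%R, 1%R]) complex.Re (f (t%:C * z)))
      +i* (\int[lebesgue_measure]_(t in `[0%R, 1%R]) complex.Im (f (t%:C * z))))
  else 0.

Variant korenblum_index :=
  | KPlus (gamma : R) of 0 <= gamma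
  | KMinus (gamma : \bar R) of (0 < gamma)%E.

Definition korenblum_set (s : korenblum_index) : set (C -> C^o) :=
  match s with
  | KPlus gamma _ => \bigcap_(mu in [set mu | gamma < mu]) growth_space mu
  | KMinus gamma _ =>
      \bigcup_(mu in [set mu | 0 < mu /\ (mu%:E < gamma)%E]) growth_space mu
  end.

Definition korenblum (s : korenblum_index) : Type :=
  {f : C -> C^o | f \in korenblum_set s}.

Lemma cabs_ge0 z : 0 <= cabs z.
Proof. by have := normr_ge0 z; rewrite lecE => /andP[]. Qed.

Lemma cabs0 : cabs 0 = 0.
Proof. by rewrite /cabs normr0. Qed.

Lemma cabsD z w : cabs (z + w) <= cabs z + cabs w.
Proof. by have := ler_normD z w; rewrite lecE => /andP[_]; rewrite raddfD. Qed.

Lemma cabsM z w : cabs (z * w) = cabs z * cabs w.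
Proof.
rewrite /cabs normrM.
by have := ger0_Im (normr_ge0 z); case: `|z| => a b /= ->; case: `|w| => c d /=;
  rewrite mul0r subr0.
Qed.

Lemma growth_normP mu f : (growth_norm mu f < +oo)%E <->
  exists M : R, forall z, unit_disc z -> (1 - cabs z) `^ mu * cabs (f z) <= M.
Proof.
split=> [fin|[M fM]]; last first.
  apply: (@le_lt_trans _ _ M%:E); last exact: ltry.
  by apply: ge_ereal_sup => _ [z zD <-]; rewrite lee_fin; exact: fM.
exists (fine (growth_norm mu f)) => z zD.
have le_z : (((1 - cabs z) `^ mu * cabs (f z))%:E <= growth_norm mu f)%E.
  by apply: ereal_sup_ubound; exists z.
rewrite -lee_fin fineK// fin_numElt fin andbT.
by apply: lt_le_trans le_z; exact: ltNyr.
Qed.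

Lemma growth_space_submod mu : submod_closed (mem (growth_space mu)).
Proof.
split.
  rewrite inE; split; first by split=> // z _; exact: derivable_cst.
  apply/growth_normP; exists 0 => z _.
  by have -> : cabs ((0 : C -> C^o) z) = 0; [exact: cabs0|rewrite mulr0].
move=> a f g; rewrite !inE => -[[df f0] /growth_normP[M fM]]
  [[dg g0] /growth_normP[N gN]]; split; first split=> z zD.
- apply: derivableD; last exact: dg.
  by apply: derivableZ; exact: df.
- have -> : (a *: f + g) z = a *: f z + g z by [].
  by rewrite f0// g0// scaler0 addr0.
apply/growth_normP; exists (cabs a * M + N) => z zD.
have w0 : 0 <= (1 - cabs z) `^ mu by exact: powR_ge0.
apply: (@le_trans _ _ (cabs a * ((1 - cabs z) `^ mu * cabs (f z)) +
   (1 - cabs z) `^ mu * cabs (g z))).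
  rewrite mulrCA -mulrDr; apply: ler_wpM2l => //.
  by rewrite -cabsM; exact: cabsD.
by apply: lerD; [apply: ler_wpM2l; [exact: cabs_ge0|exact: fM]|exact: gN].
Qed.

Lemma growth_space_mono mu nu : mu <= nu -> growth_space mu `<=` growth_space nu.
Proof.
move=> munu f [hf /growth_normP[M fM]]; split=> //.
apply/growth_normP; exists M => z zD; apply: le_trans (fM z zD).
apply: ler_wpM2r; first exact: cabs_ge0.
apply: ger_powR => //; rewrite subr_gt0 zD/= lerBlDr lerDl; exact: cabs_ge0.
Qed.

Lemma korenblum_submod s : submod_closed (mem (korenblum_set s)).
Proof.
case: s => gamma g0 /=; split.
- rewrite inE => mu _; have [h _] := growth_space_submod mu.
  by move: h; rewrite inE.
- move=> a f g; rewrite !inE => hf hg mu gmu.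
  have [_ h] := growth_space_submod mu.
  have := h a f g; rewrite !inE; apply; [exact: hf|exact: hg].
- rewrite inE.
  have [mu [mu0 mug]] : exists mu : R, 0 < mu /\ (mu%:E < gamma)%E.
    case: gamma g0 => [r r0|_|//]; last by exists 1; rewrite ltr01 ltry.
    by rewrite lte_fin in r0; exists (r / 2); rewrite lte_fin divr_gt0// gtr_pMr//
      invf_lt1// ltr1n.
  exists mu => //; have [h _] := growth_space_submod mu.
  by move: h; rewrite inE.
- move=> a f g; rewrite !inE => -[mu [mu0 mug] hf] [nu [nu0 nug] hg].
  have [_ h] := growth_space_submod (Num.max mu nu).
  exists (Num.max mu nu).
    by split; [rewrite lt_max mu0|case: (leP mu nu)].
  have := h a f g; rewrite !inE; apply.
    by apply: growth_space_mono hf; rewrite le_max lexx.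
  by apply: growth_space_mono hg; rewrite le_max lexx orbT.
Qed.

HB.instance Definition _ s := SubChoice.on (korenblum s).
HB.instance Definition _ s :=
  GRing.SubChoice_isSubLmodule.Build C (C -> C^o) _ (korenblum s)
    (GRing.submod_closed_semi (korenblum_submod s)).

(* A topology on E, given by its open sets, is locally convex when it is the
   topology of some locally convex space, transported by a linear bijection. *)
Definition locally_convex_topology (E : lmodType C) (tau : set_system E) :=
  exists (T : tvsType C) (phi : {linear E -> T}),
    bijective phi /\ tau = [set phi @^-1` U | U in open].

(* The inclusion of the Banach space growth_space mu in korenblum s, defined on
   the elements that korenblum s and growth_space mu share, is continuous. *)
Definition inclusion_continuous s (mu : R) (tau : set_system (korenblum s)) :=
  forall O f, tau O -> O f -> growth_space mu (val f) ->
    exists2 e : R, 0 < e & forall g, growth_space mu (val g) ->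
      (growth_norm mu (val g - val f)%R < e%:E)%E -> O g.

(* KPlus: balls of the norms growth_norm (gamma + 1/k), k >= 1.
   KMinus: the locally convex topologies making all the inclusions continuous
   are stable under suprema, so the finest of them is their supremum, i.e. the
   topology generated by the open sets of all of them. *)
Definition korenblum_subbase s : set_system (korenblum s) :=
  match s with
  | KPlus gamma _ => [set O | exists (k : nat) (f : korenblum s) (e : R),
      [/\ (0 < k)%N, 0 < e &
        O = [set g | (growth_norm (gamma + k%:R^-1) (val g - val f)%R < e%:E)%E]]]
  | KMinus gamma _ => [set O | exists2 tau : set_system (korenblum s),
      locally_convex_topology tau /\
      (forall mu : R, 0 < mu -> (mu%:E < gamma)%E -> inclusion_continuous mu tau)
      & tau O]
  end.

HB.instance Definition _ s :=
  isSubBaseTopological.Build (korenblum s) (@korenblum_subbase s) id.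

End growth_spaces.

(* Main.v *)
(* On the sequence [taylor f n = f^(n)(0)] the operator J acts as the right
   shift, so [p(J) f] corresponds to the product of [p] with the formal power
   series [sum_n f^(n)(0) x^n]. Let K be the least order at 0 of an element of M
   and let [f] in M have order K: its series is [x^K b(x)] with [b(0) <> 0].
   Polynomial growth of the Taylor coefficients of [f] means [b_n = O((n+p)!)],
   and then [1/b] has coefficients [O((n+q)!)]. Truncating [1/b] and applying it
   to [J^L f] with L large therefore gives elements of M converging uniformly on
   the disc to [z^(K+L)/(K+L)!]. Hence M contains [z^n] for all large n, and, by
   dilations and Taylor polynomials, every function of large order. The crude
   loss of L orders is recovered by descending induction: if M contains all
   functions of order at least n+1 and n >= K, then subtracting a multiple of
   [J^(n-K) f] shows that it contains those of order n.

   Power series expansions come from Cauchy's formula, for which Goursat's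
   bisection is run in the parameters of the homotopy [z0 + s(r e^(it) - z0)]. *)
Require Import Defs.
From HB Require Import structures.
From mathcomp Require Import all_boot all_order all_algebra.
From mathcomp Require Import all_classical all_reals all_analysis.
From mathcomp.real_closed Require Import complex.
From mathcomp Require Import finmap ring lra zify.

Set Implicit Arguments.
Unset Strict Implicit.
Unset Printing Implicit Defensive.

Import Order.TTheory GRing.Theory Num.Theory.
Import numFieldNormedType.Exports.

Local Open Scope classical_set_scope.
Local Open Scope ring_scope.
Local Open Scope complex_scope.


(** * Sums and complex derivatives in terms of a real modulus *)

(** Two obstacles shape the proof. The topology of a [KMinus] space is given only as a supremum of
    locally convex topologies, without explicit neighbourhoods of 0. Continuity of J is therefore
    obtained by pulling those topologies back along J, and closedness of M is used only through
    sequences that converge in a single weight. Secondly, a bound in one weight does not make Taylor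
    polynomials converge in that weight. Dilations do converge, in every strictly larger exponent,
    and both families leave room for one: between gamma and gamma + 1/k for [KPlus], between the
    exponent of the function and gamma for [KMinus].

    The series b and 1/b may diverge everywhere, so 1/b is handled by estimates on its recursion
    alone. These close because factorials almost absorb convolution: for q much larger than p, the
    sum of (j+q)! (n-j+p)! over j < n is a small multiple of (n+q)!. *)

Section modulus.
Variable R : realType.
Local Notation C := R[i].
Implicit Types z w : C.

Lemma cabsE z : `|z| = (cabs z)%:C.
Proof. by rewrite /cabs normc_def. Qed.

Lemma cabs_eq0 z : (cabs z == 0) = (z == 0).
Proof.
rewrite -[RHS]normr_eq0 cabsE; apply/eqP/eqP => [->//|].
by move/(congr1 (@complex.Re R)).
Qed.

Lemma cabsN z : cabs (- z) = cabs z.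
Proof. by rewrite /cabs normrN. Qed.

Lemma cabsB z w : cabs (z - w) = cabs (w - z).
Proof. by rewrite -cabsN opprB. Qed.

Lemma cabs1 : cabs (1 : C) = 1.
Proof. by rewrite /cabs normr1. Qed.

Lemma cabsX z n : cabs (z ^+ n) = cabs z ^+ n.
Proof.
by elim: n => [|n ih]; rewrite ?expr0 ?cabs1// !exprS cabsM ih.
Qed.

Lemma cabsV z : cabs z^-1 = (cabs z)^-1.
Proof.
have [->|z0] := eqVneq z 0; first by rewrite invr0 cabs0 invr0.
apply: (mulfI (x := cabs z)); first by rewrite cabs_eq0.
by rewrite -cabsM !divff ?cabs1// cabs_eq0.
Qed.

Lemma cabs_real (x : R) : cabs x%:C = `|x|.
Proof. by rewrite /cabs normc_def/= expr0n/= addr0 sqrtr_sqr. Qed.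

Lemma cabs_i : cabs ('i%C : C) = 1.
Proof. by rewrite /cabs normc_def/= expr0n/= add0r expr1n sqrtr1. Qed.

Lemma cabs_nat n : cabs (n%:R : C) = n%:R.
Proof.
have -> : (n%:R : C) = (n%:R : R)%:C by rewrite rmorph_nat.
by rewrite cabs_real ger0_norm.
Qed.

Lemma cabs_dist z w : `|cabs z - cabs w| <= cabs (z - w).
Proof.
rewrite ler_norml; apply/andP; split.
  have := cabsD z (w - z); rewrite addrC subrK cabsB; lra.
by have := cabsD w (z - w); rewrite addrC subrK; lra.
Qed.

Lemma Re_cabs z : `|complex.Re z| <= cabs z.
Proof. by have := normc_ge_Re z; rewrite cabsE lecR. Qed.

Lemma Im_cabs z : `|complex.Im z| <= cabs z.
Proof.
have := Re_cabs (z * 'i%C); rewrite ReiNIm normrN cabsM.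
by rewrite cabs_i mulr1.
Qed.

Lemma cabs_ReIm z : cabs z <= `|complex.Re z| + `|complex.Im z|.
Proof.
case: z => a b /=; have -> : a +i* b = a%:C + 'i%C * b%:C.
  by rewrite {1}(complexE (a +i* b)).
by apply: le_trans (cabsD _ _) _; rewrite cabsM !cabs_real cabs_i mul1r.
Qed.

Lemma cabs_sum (I : Type) (r : seq I) (P : pred I) (F : I -> C) :
  cabs (\sum_(i <- r | P i) F i) <= \sum_(i <- r | P i) cabs (F i).
Proof.
elim/big_ind2: _ => //; first by rewrite cabs0.
by move=> x x' y y' xx yy; apply: le_trans (cabsD _ _) _; exact: lerD.
Qed.

Lemma Re_sum (I : Type) (r : seq I) (P : pred I) (F : I -> C) :
  complex.Re (\sum_(i <- r | P i) F i) = \sum_(i <- r | P i) complex.Re (F i).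
Proof. by apply: big_morph => // -[a b] [c d]. Qed.

Lemma Im_sum (I : Type) (r : seq I) (P : pred I) (F : I -> C) :
  complex.Im (\sum_(i <- r | P i) F i) = \sum_(i <- r | P i) complex.Im (F i).
Proof. by apply: big_morph => // -[a b] [c d]. Qed.

(** Radii of balls in [C^o] are complex numbers, but a positive one has imaginary part 0. From here
    on all estimates use real radii. *)
Lemma nbhs_cabsP z (A : set C) :
  nbhs (z : C^o) A <-> exists2 d : R, 0 < d & forall w, cabs (w - z) < d -> A w.
Proof.
split=> [|[d d0 dA]].
  rewrite -nbhs_ballE => -[e /= e0 eA]; exists (complex.Re e).
    by move: e0; rewrite ltcE => /andP[].
  move=> w wd; apply: eA; rewrite -ball_normE/= distrC cabsE ltcE/= wd andbT.
  by move: e0; rewrite ltcE/= => /andP[].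
rewrite -nbhs_ballE; exists d%:C; first by rewrite /= ltcR.
by move=> w; rewrite -ball_normE/= distrC cabsE ltcR => /dA.
Qed.

Lemma dnbhs_cabsP (A : set C) : nbhs ((0 : C^o)^') A <->
  exists2 d : R, 0 < d & forall h, h != 0 -> cabs h < d -> A h.
Proof.
rewrite /dnbhs nbhs_simpl/= /within/=; split.
  move=> /nbhs_cabsP[d d0 dA]; exists d => // h h0 hd; apply: dA => //.
  by rewrite subr0.
move=> [d d0 dA]; apply/nbhs_cabsP; exists d => // h; rewrite subr0 => hd h0.
exact: dA.
Qed.

(** Differentiability as a first-order expansion: without a quotient, [w = z] needs no separate
    treatment. *)
Definition cdiff (f : C -> C) z d := forall e : R, 0 < e ->
  exists2 r : R, 0 < r &
    forall w, cabs (w - z) < r -> cabs (f w - f z - d * (w - z)) <= e * cabs (w - z).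

Lemma cdiff_cvgP (f : C -> C) z d : cdiff f z d <->
  (fun h : C^o => h^-1 *: ((f (h *: (1 : C^o) + z) : C^o) - f z)) @ (0 : C^o)^' --> (d : C^o).
Proof.
split=> [fz|].
  apply/(@cvgrPdist_le _ C^o) => e e0.
  have e0' : 0 < complex.Re e by move: e0; rewrite ltcE => /andP[].
  have [r r0 rf] := fz _ e0'.
  apply/dnbhs_cabsP; exists r => // h h0 hr.
  have eE : e = (complex.Re e)%:C.
    by case: e e0 {e0' rf} => a b; rewrite ltcE /= => /andP[/eqP -> _].
  rewrite cabsE eE lecR/= /GRing.scale/= mulr1.
  have := rf (h + z); rewrite addrK => /(_ hr) hle.
  have := cabsM h (d - h^-1 * (f (h + z) - f z)).
  rewrite mulrBr mulrA divff// mul1r cabsB [h * d]mulrC => hE.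
  move: hle; rewrite hE mulrC ler_pM2r//.
  by rewrite lt_def cabs_eq0 h0 cabs_ge0.
move=> /(@cvgrPdist_le _ C^o) H e e0.
have /H : 0 < e%:C by rewrite ltcR.
move=> /dnbhs_cabsP[r r0 rf]; exists r => // w wr.
have [->|wz] := eqVneq w z; first by rewrite !subrr mulr0 subrr cabs0 mulr0.
rewrite -subr_eq0 in wz; move/(_ _ wz wr): rf.
rewrite /= cabsE lecR /GRing.scale/= mulr1 subrK => h.
have : cabs (w - z) * cabs (d - (w - z)^-1 * (f w - f z)) <= e * cabs (w - z).
  by rewrite [e * _]mulrC ler_wpM2l// cabs_ge0.
rewrite -cabsM mulrBr mulrA divff// mul1r => h2; apply: le_trans h2.
by rewrite -cabsN opprB [d * _]mulrC.
Qed.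

Lemma derivable_cdiff (f : C -> C) z :
  @derivable C C^o C^o f z 1 -> exists d, cdiff f z d.
Proof.
by move=> /cvg_ex[d fd]; exists d; apply/cdiff_cvgP.
Qed.

Lemma cdiff_derivable (f : C -> C) z d :
  cdiff f z d -> @derivable C C^o C^o f z 1.
Proof. by move=> /cdiff_cvgP fd; apply/cvg_ex; exists d. Qed.

Lemma cdiff_derive1 (f : C -> C) z d :
  cdiff f z d -> @derive1 C C^o (f : C^o -> C^o) z = d.
Proof.
move=> /cdiff_cvgP fd; rewrite derive1E /derive; apply: cvg_lim => //.
Qed.

Lemma cdiff_cont (f : C -> C) z d : cdiff f z d -> forall e : R, 0 < e ->
  exists2 r : R, 0 < r & forall w, cabs (w - z) < r -> cabs (f w - f z) <= e.
Proof.
move=> /(_ _ ltr01)[r r0 rf] e e0.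
have k0 : 0 < 1 + cabs d by have := cabs_ge0 d; lra.
exists (Num.min r (e / (1 + cabs d))).
  by rewrite lt_min r0 divr_gt0.
move=> w; rewrite lt_min ltr_pdivlMr// => /andP[/rf h1 h2].
rewrite -[f w - f z](subrK (d * (w - z))).
apply: le_trans (cabsD _ _) _; rewrite cabsM; lra.
Qed.

End modulus.

(** * Convergent and absolutely convergent complex series *)

Section sums.
Variable R : realType.
Local Notation C := R[i].
Implicit Types (u v : nat -> C).

Definition csum u (l : C) := forall e : R, 0 < e ->
  exists N, forall n, (N <= n)%N -> cabs (\sum_(i < n) u i - l) < e.

Lemma cabs_le_eps (l : C) (B : R) : (forall e, 0 < e -> cabs l <= B + e) -> cabs l <= B.
Proof. by move=> h; apply/ler_addgt0Pr => e; exact: h. Qed.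

Lemma csum_le u l (B : R) : (forall n, cabs (\sum_(i < n) u i) <= B) ->
  csum u l -> cabs l <= B.
Proof.
move=> uB ul; apply: cabs_le_eps => e e0; have [N /(_ _ (leqnn N)) h] := ul e e0.
have := uB N; have := cabsD (\sum_(i < N) u i) (l - \sum_(i < N) u i).
by rewrite addrC subrK cabsB; rewrite [cabs (_ - l)]cabsB in h *; lra.
Qed.

Lemma csum_abs_le u l (B : R) : (forall n, \sum_(i < n) cabs (u i) <= B) ->
  csum u l -> cabs l <= B.
Proof.
by move=> uB; apply: csum_le => n; apply: le_trans (cabs_sum _ _ _) (uB n).
Qed.

Lemma csumD u v l l' : csum u l -> csum v l' -> csum (fun n => u n + v n) (l + l').
Proof.
move=> ul vl e e0; have e2 : 0 < e / 2 by lra.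
have [N hN] := ul _ e2; have [M hM] := vl _ e2.
exists (maxn N M) => n; rewrite geq_max => /andP[/hN h1 /hM h2].
rewrite big_split/= opprD addrACA; apply: le_lt_trans (cabsD _ _) _; lra.
Qed.

Lemma csumZ a u l : csum u l -> csum (fun n => a * u n) (a * l).
Proof.
move=> ul e e0; have k0 : 0 < 1 + cabs a by have := cabs_ge0 a; lra.
have [N hN] := ul _ (divr_gt0 e0 k0); exists N => n /hN.
rewrite ltr_pdivlMr// -mulr_sumr -mulrBr cabsM => h.
by apply: le_lt_trans h; have := cabs_ge0 (\sum_(i < n) u i - l); nra.
Qed.

(** The termwise difference of the series with itself has zero partial sums, and [csum_le] carries
    the bound 0 to [l - l']. *)
Lemma csum_uniq u l l' : csum u l -> csum u l' -> l = l'.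
Proof.
move=> ul /(csumZ (-1)) ul'; have := csumD ul ul' => h.
apply/eqP; rewrite -subr_eq0 -cabs_eq0 eq_le cabs_ge0 andbT.
have := csum_le (B := 0) _ h; rewrite mulN1r; apply => n.
by rewrite big1 ?cabs0// => i _; rewrite mulN1r subrr.
Qed.

Lemma csum_finite u n : (forall i, (n <= i)%N -> u i = 0) ->
  csum u (\sum_(i < n) u i).
Proof.
move=> u0 e e0; exists n => m nm.
rewrite -(big_mkord xpredT) -(big_mkord xpredT u) (big_cat_nat _ nm)//=.
rewrite addrAC subrr add0r big_nat_cond big1 ?cabs0// => i /andP[/andP[/u0]].
by [].
Qed.

Lemma csumS u l : csum (fun n => u n.+1) l -> csum u (u 0 + l).
Proof.
move=> ul e e0; have [N hN] := ul _ e0; exists N.+1 => -[//|n]; rewrite ltnS => /hN.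
by rewrite big_ord_recl opprD addrACA subrr add0r.
Qed.

Lemma rseries_ex (w : nat -> R) (B : R) : (forall n, \sum_(i < n) `|w i| <= B) ->
  exists l, forall e : R, 0 < e ->
    exists N, forall n, (N <= n)%N -> `|\sum_(i < n) w i - l| < e.
Proof.
move=> wB.
have : cvgn (series w).
  apply: normed_cvg; apply: nondecreasing_is_cvgn.
    apply/nondecreasing_seqP => n; rewrite /normed_series_of/= /series/= big_nat_recr//= lerDl.
    exact: normr_ge0.
  by exists B => _ [n _ <-]; rewrite /normed_series_of/= /series/= big_mkord.
move=> /cvg_ex[l /(@cvgrPdist_lt _ R) wl]; exists l => e /wl[N _ hN].
exists N => n /hN; rewrite distrC /series/= big_mkord; exact.
Qed.

Lemma csum_ex u (B : R) : (forall n, \sum_(i < n) cabs (u i) <= B) ->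
  exists l, csum u l.
Proof.
move=> uB.
have [a ha] : exists a, forall e : R, 0 < e -> exists N, forall n, (N <= n)%N ->
    `|\sum_(i < n) complex.Re (u i) - a| < e.
  by apply: (@rseries_ex (fun i => complex.Re (u i)) B) => n; apply: le_trans (uB n);
    apply: ler_sum => i _; exact: Re_cabs.
have [b hb] : exists b, forall e : R, 0 < e -> exists N, forall n, (N <= n)%N ->
    `|\sum_(i < n) complex.Im (u i) - b| < e.
  by apply: (@rseries_ex (fun i => complex.Im (u i)) B) => n; apply: le_trans (uB n);
    apply: ler_sum => i _; exact: Im_cabs.
exists (a +i* b) => e e0; have e2 : 0 < e / 2 by lra.
have [N hN] := ha _ e2; have [M hM] := hb _ e2.
exists (maxn N M) => n; rewrite geq_max => /andP[/hN h1 /hM h2].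
apply: le_lt_trans (cabs_ReIm _) _; rewrite !raddfB/= Re_sum Im_sum; lra.
Qed.

End sums.

(** * Geometric series with polynomial weights *)

Section polynomial_weights.
Variable R : realType.

Lemma geo_le (x : R) n : 0 <= x -> x < 1 -> \sum_(i < n) x ^+ i <= (1 - x)^-1.
Proof.
move=> x0 x1; have x1' : 0 < 1 - x by lra.
rewrite -(ler_pM2l x1') divff; last by rewrite gt_eqF.
by rewrite -opprB mulNr -subrX1 opprB lerBlDr lerDl exprn_ge0.
Qed.

(* The mean value inequality for [x ^ n] trades a factor [n] for a larger base. *)
Lemma natmul_expr_le (x y : R) n : 0 <= x -> x < y ->
  n.+1%:R * x ^+ n <= y / (y - x) * y ^+ n.
Proof.
move=> x0 xy; have d0 : 0 < y - x by lra.
rewrite mulrAC ler_pdivlMr// -exprS.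
suff : n.+1%:R * x ^+ n * (y - x) <= y ^+ n.+1 - x ^+ n.+1.
  by have := exprn_ge0 n.+1 x0; lra.
elim: n => [|n ih]; first by rewrite expr0 !expr1; lra.
have h1 := ler_wpM2l x0 ih.
have h2 : (y - x) * x ^+ n.+1 <= (y - x) * y ^+ n.+1.
  by apply: ler_wpM2l; [lra|rewrite lerXn2r ?nnegrE; lra].
move: h1 h2; rewrite [x ^+ n.+2]exprS [y ^+ n.+2]exprS -[n.+2]addn1 natrD.
by rewrite ![x ^+ n.+1]exprS; lra.
Qed.

(** Each of the [p] factors [i.+1] is absorbed by moving the base to the midpoint of [x] and 1,
    which is still below 1. *)
Lemma polyexp_sum (p : nat) (x : R) : 0 <= x -> x < 1 ->
  exists B, forall n, \sum_(i < n) i.+1%:R ^+ p * x ^+ i <= B.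
Proof.
elim: p x => [|p ih] x x0 x1.
  exists (1 - x)^-1 => n; under eq_bigr do rewrite expr0 mul1r; exact: geo_le.
have [y1 xy] : (x + 1) / 2 < 1 /\ x < (x + 1) / 2 by lra.
set y := (x + 1) / 2 in y1 xy; have y0 : 0 <= y by lra.
have [B hB] := ih y y0 y1.
exists (y / (y - x) * B) => n; have k0 : 0 <= y / (y - x) by apply: divr_ge0; lra.
apply: le_trans (ler_wpM2l k0 (hB n)); rewrite mulr_sumr; apply: ler_sum => i _.
rewrite exprSr -mulrA [y / _ * _]mulrCA.
by apply: ler_wpM2l; [exact: exprn_ge0|exact: natmul_expr_le].
Qed.

End polynomial_weights.

(** * Power series on the unit disc *)

Section power_series.
Variable R : realType.
Local Notation C := R[i].
Implicit Types (a b : nat -> C).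

(** All that is kept of a function in some [growth_space] (see [growth_taylor]). The condition
    survives termwise differentiation and integration and forces convergence on the disc. *)
Definition polybnd a := exists p (B : R), forall n, cabs (a n) <= B * n.+1%:R ^+ p.

Lemma polybnd_mono a : polybnd a -> exists p (B : R), [/\ 0 <= B &
  forall q, (p <= q)%N -> forall n, cabs (a n) <= B * n.+1%:R ^+ q].
Proof.
move=> [p [B hB]]; have B0 : 0 <= B.
  by have := hB 0; rewrite expr1n mulr1; apply: le_trans; exact: cabs_ge0.
exists p, B; split=> // q pq n; apply: le_trans (hB n) _.
by apply: ler_wpM2l => //; rewrite ler_weXn2l// ler1n.
Qed.

Lemma polybndD a b : polybnd a -> polybnd b -> polybnd (fun n => a n + b n).
Proof.
move=> /polybnd_mono[p [B [B0 hB]]] /polybnd_mono[q [D [D0 hD]]].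
exists (maxn p q), (B + D) => n; apply: le_trans (cabsD _ _) _; rewrite mulrDl.
by apply: lerD; [apply: hB; exact: leq_maxl|apply: hD; exact: leq_maxr].
Qed.

Lemma polybndZ c a : polybnd a -> polybnd (fun n => c * a n).
Proof.
move=> [p [B hB]]; exists p, (cabs c * B) => n; rewrite cabsM -mulrA.
by apply: ler_wpM2l => //; exact: cabs_ge0.
Qed.

Lemma polybnd_natmul a : polybnd a -> polybnd (fun n => n%:R * a n).
Proof.
move=> [p [B hB]]; exists p.+1, B => n; rewrite cabsM cabs_nat exprS mulrCA.
by apply: ler_pM => //; [exact: cabs_ge0|rewrite ler_nat].
Qed.

Lemma polybnd_abs_sum a (x : R) : polybnd a -> 0 <= x -> x < 1 ->
  exists2 B : R, 0 <= B & forall n, \sum_(i < n) cabs (a i) * x ^+ i <= B.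
Proof.
move=> [p [B hB]] x0 x1; have [D hD] := polyexp_sum p x0 x1.
have B0 : 0 <= B.
  by have := hB 0; rewrite expr1n mulr1; apply: le_trans; exact: cabs_ge0.
exists (B * D).
  by apply: mulr_ge0 => //; have := hD 0; rewrite big_ord0.
move=> n; apply: le_trans (ler_wpM2l B0 (hD n)); rewrite mulr_sumr.
by apply: ler_sum => i _; rewrite mulrA; apply: ler_wpM2r => //; exact: exprn_ge0.
Qed.

Lemma power_sum_ex a (z : C) : polybnd a -> cabs z < 1 ->
  exists l, csum (fun n => a n * z ^+ n) l.
Proof.
move=> pa z1; have [B _ hB] := polybnd_abs_sum pa (cabs_ge0 z) z1.
apply: (@csum_ex _ _ B) => n; apply: le_trans (hB n); apply: ler_sum => i _.
by rewrite cabsM cabsX.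
Qed.

(** Zero off the disc, as [holomorphic] requires. On the disc the default of [xget] is not reached
    once [a] is [polybnd]. *)
Definition psf a : C -> C^o := fun z =>
  if cabs z < 1 then xget 0 [set l | csum (fun n => a n * z ^+ n) l] else 0.

Lemma psfP a z : polybnd a -> cabs z < 1 -> csum (fun n => a n * z ^+ n) (psf a z).
Proof.
move=> pa z1; rewrite /psf z1; have [l hl] := power_sum_ex pa z1.
exact: (@xgetPex _ 0 [set l | csum (fun n => a n * z ^+ n) l] (ex_intro _ l hl)).
Qed.

Lemma psf_eq a z l : cabs z < 1 -> csum (fun n => a n * z ^+ n) l -> psf a z = l.
Proof.
move=> z1 hl; rewrite /psf z1.
have h := @xgetPex _ 0 [set l | csum (fun n => a n * z ^+ n) l] (ex_intro _ l hl).
exact: csum_uniq h hl.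
Qed.

Lemma psf_out a z : ~ cabs z < 1 -> psf a z = 0.
Proof. by rewrite /psf; case: ifP. Qed.

Lemma psf0 a : psf a 0 = a 0.
Proof.
apply: psf_eq; first by rewrite cabs0.
have := @csum_finite _ (fun n => a n * 0 ^+ n) 1.
rewrite big_ord1 expr0 mulr1; apply=> -[//|i] _.
by rewrite expr0n mulr0.
Qed.

Lemma psfD a b : polybnd a -> polybnd b ->
  psf (fun n => a n + b n) = psf a + psf b.
Proof.
move=> pa pb; apply/funext => z; rewrite fctE.
have [z1|z1] := boolP (cabs z < 1); last by rewrite !psf_out ?addr0//; exact/negP.
apply: psf_eq => //; under eq_fun do rewrite mulrDl.
exact: csumD (psfP pa z1) (psfP pb z1).
Qed.

Lemma psfZ c a : polybnd a -> psf (fun n => c * a n) = c *: psf a.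
Proof.
move=> pa; apply/funext => z; rewrite fctE.
have [z1|z1] := boolP (cabs z < 1); last by rewrite !psf_out ?scaler0//; exact/negP.
apply: psf_eq => //; under eq_fun do rewrite -mulrA.
exact: csumZ (psfP pa z1).
Qed.

Lemma psf_bound a z (B : R) : polybnd a -> (forall n, \sum_(i < n) cabs (a i) <= B) ->
  cabs (psf a z) <= B.
Proof.
move=> pa hB; have B0 : 0 <= B by have := hB 0; rewrite big_ord0.
have [z1|z1] := boolP (cabs z < 1); last by rewrite psf_out ?cabs0//; exact/negP.
apply: csum_abs_le (psfP pa z1) => n; apply: le_trans (hB n); apply: ler_sum => i _.
rewrite cabsM cabsX ler_piMr ?cabs_ge0// exprn_ile1 ?cabs_ge0//; exact: ltW.
Qed.

(** The remainders satisfy e_(n+1) = w e_n + n z^(n-1) (w - z)^2. The factor [x ^+ 2] on the left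
    stands for the exponent n - 2 on the right, which would be truncated for n < 2. *)
Lemma power_second_order (w z : C) (x : R) n : cabs w <= x -> cabs z <= x ->
  x ^+ 2 * cabs (w ^+ n - z ^+ n - n%:R * z ^+ n.-1 * (w - z)) <=
  n%:R ^+ 2 * x ^+ n * cabs (w - z) ^+ 2.
Proof.
move=> wx zx; have x0 : 0 <= x by apply: le_trans wx; exact: cabs_ge0.
elim: n => [|n ih].
  by rewrite !expr0 subrr !mul0r subrr cabs0 mulr0 expr0n/= !mul0r.
set e := _ - _ in ih; rewrite -/e in ih.
have -> : w ^+ n.+1 - z ^+ n.+1 - n.+1%:R * z ^+ n.+1.-1 * (w - z) =
    w * e + n%:R * z ^+ n.-1 * (w - z) ^+ 2.
  rewrite /e /= !exprS -addn1 natrD; case: (n) => [|m]/=; first by rewrite !expr0; ring.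
  by rewrite !exprS; ring.
have le1 : cabs (w * e) <= x * cabs e.
  by rewrite cabsM; apply: ler_wpM2r => //; exact: cabs_ge0.
have x20 : 0 <= x ^+ 2 by exact: exprn_ge0.
have le2 : x ^+ 2 * cabs (n%:R * z ^+ n.-1 * (w - z) ^+ 2) <=
    n%:R * x ^+ n.+1 * cabs (w - z) ^+ 2.
  rewrite !cabsM cabs_nat !cabsX mulrA; apply: ler_wpM2r; first exact: sqr_ge0.
  rewrite mulrCA; case: (n) => [|m]; first by rewrite !mul0r.
  apply: ler_wpM2l => //.
  rewrite !exprS mulrA expr0 mulr1 [in leRHS]mulrA; apply: ler_wpM2l; first exact: mulr_ge0.
  by rewrite lerXn2r ?nnegrE ?cabs_ge0.
have n0 : 0 <= (n%:R : R) by [].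
have -> : n.+1%:R ^+ 2 * x ^+ n.+1 * cabs (w - z) ^+ 2 =
  x * (n%:R ^+ 2 * x ^+ n * cabs (w - z) ^+ 2) + n%:R * x ^+ n.+1 * cabs (w - z) ^+ 2
  + n.+1%:R * x ^+ n.+1 * cabs (w - z) ^+ 2.
  have -> : n.+1%:R = n%:R + 1 :> R by rewrite natr1.
  by rewrite [x ^+ n.+1]exprS; ring.
apply: le_trans (ler_wpM2l x20 (cabsD _ _)) _; rewrite mulrDr.
have h0 : 0 <= n.+1%:R * x ^+ n.+1 * cabs (w - z) ^+ 2.
  by apply: mulr_ge0; [apply: mulr_ge0 => //; exact: exprn_ge0|exact: sqr_ge0].
have h1 := ler_wpM2l x20 le1; have h2 := ler_wpM2l x0 ih.
rewrite mulrCA in h1; lra.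
Qed.

Definition dshift a n := n.+1%:R * a n.+1.

Lemma polybnd_dshift a : polybnd a -> polybnd (dshift a).
Proof.
move=> /polybnd_natmul[p [B hB]]; exists p, (B * 2 ^+ p) => n.
have B0 : 0 <= B.
  by have := hB 0; rewrite expr1n mulr1; apply: le_trans; exact: cabs_ge0.
apply: le_trans (hB n.+1) _; rewrite -mulrA; apply: ler_wpM2l => //.
rewrite -exprMn lerXn2r ?nnegrE//.
  by rewrite -natrM ler_nat; lia.
Qed.

Lemma polybnd_dshift_iter a j : polybnd a -> polybnd (iter j dshift a).
Proof. by elim: j => // j ih /ih; exact: polybnd_dshift. Qed.

Lemma psf_cdiff a z : polybnd a -> cabs z < 1 -> cdiff (psf a) z (psf (dshift a) z).
Proof.
move=> pa z1; set x := (cabs z + 1) / 2.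
have [x1 zx] : x < 1 /\ cabs z < x by rewrite /x; lra.
have x0 : 0 < x by apply: le_lt_trans zx; exact: cabs_ge0.
(* The second-order remainder of z^n carries the factor n^2, hence [polybnd_natmul] twice. *)
have [B B0 hB] := polybnd_abs_sum (polybnd_natmul (polybnd_natmul pa)) (ltW x0) x1.
have x20 : 0 < x ^+ 2 by exact: exprn_gt0.
(* The first bound keeps [w] in the disc of radius [x]; the second turns the quadratic remainder
   into [e * cabs (w - z)]. *)
move=> e e0; exists (Num.min (x - cabs z) (e * x ^+ 2 / (B + 1))).
  by rewrite lt_min subr_gt0 zx/=; apply: divr_gt0; [exact: mulr_gt0|lra].
move=> w; rewrite lt_min ltr_pdivlMr; last by lra.
move=> /andP[wz wB].
have wx : cabs w <= x by have := cabsD z (w - z); rewrite addrC subrK; lra.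
have w1 : cabs w < 1 by exact: le_lt_trans x1.
(* The derived series is reindexed to start at n = 0, where its term vanishes, so that it can be
   subtracted termwise. *)
have hd : csum (fun n => n%:R * a n * z ^+ n.-1) (psf (dshift a) z).
  have := @csumS _ (fun n => n%:R * a n * z ^+ n.-1) _ (psfP (polybnd_dshift pa) z1).
  by rewrite !mul0r add0r.
have h := csumD (csumD (psfP pa w1) (csumZ (-1) (psfP pa z1))) (csumZ (- (w - z)) hd).
have {h} h := csum_abs_le (B := B * cabs (w - z) ^+ 2 / x ^+ 2) _ h.
have : cabs (psf a w - psf a z - psf (dshift a) z * (w - z)) <=
    B * cabs (w - z) ^+ 2 / x ^+ 2.
  apply: le_trans (h _) => [|n]; first by rewrite mulN1r [in leRHS]mulNr [_ * (w - z)]mulrC.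
  rewrite ler_pdivlMr// mulrC mulr_sumr.
  apply: le_trans (ler_wpM2r (sqr_ge0 _) (hB n)); rewrite mulr_suml.
  apply: ler_sum => i _.
  have -> : a i * w ^+ i + -1 * (a i * z ^+ i) + - (w - z) * (i%:R * a i * z ^+ i.-1) =
    a i * (w ^+ i - z ^+ i - i%:R * z ^+ i.-1 * (w - z)) by ring.
  rewrite !cabsM !cabs_nat mulrCA.
  have := ler_wpM2l (cabs_ge0 (a i)) (power_second_order i wx (ltW zx)).
  by rewrite cabsB !expr2; lra.
move=> h1; apply: le_trans h1 _; rewrite ler_pdivrMr// expr2.
have := cabs_ge0 (w - z) => c0.
have : B * cabs (w - z) <= e * x ^+ 2 by nra.
by move=> /(ler_wpM2r c0); lra.
Qed.

Lemma cdiff_ext (f g : C -> C) z d (r : R) : 0 < r ->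
  (forall w, cabs (w - z) < r -> f w = g w) -> cdiff g z d -> cdiff f z d.
Proof.
move=> r0 fg gd e /gd[s s0 hs]; exists (Num.min r s); first by rewrite lt_min r0.
move=> w; rewrite lt_min => /andP[wr ws].
by rewrite fg// fg ?subrr ?cabs0//; exact: hs.
Qed.

Lemma psf_derive1n a j z : polybnd a -> cabs z < 1 ->
  @derive1n C C^o j (psf a : C^o -> C^o) z = psf (iter j dshift a) z.
Proof.
move=> pa; elim: j z => [|j ih] z z1; first by rewrite derive1n0.
rewrite derive1nS; apply: cdiff_derive1.
apply: (@cdiff_ext _ (psf (iter j dshift a)) _ _ (1 - cabs z)); first by rewrite subr_gt0.
  move=> w wz; apply: ih; have := cabsD z (w - z); rewrite addrC subrK; lra.
by rewrite iterS; apply: psf_cdiff => //; exact: polybnd_dshift_iter.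
Qed.

Lemma dshift_iterE a j n : n`!%:R * iter j dshift a n = (n + j)`!%:R * a (n + j)%N.
Proof.
elim: j n => [|j ih] n; first by rewrite addn0.
by rewrite iterS /dshift mulrA -natrM mulnC -factS ih addSnnS.
Qed.

Lemma psf_derive1n0 a n : polybnd a ->
  @derive1n C C^o n (psf a : C^o -> C^o) 0 = n`!%:R * a n.
Proof.
move=> pa; rewrite psf_derive1n ?cabs0// psf0.
by have := dshift_iterE a n 0; rewrite mul1r.
Qed.

Lemma psf_inj a b : polybnd a -> polybnd b -> psf a = psf b -> a =1 b.
Proof.
move=> pa pb ab n; apply: (mulfI (x := n`!%:R)).
  by rewrite pnatr_eq0 -lt0n fact_gt0.
by rewrite -!psf_derive1n0// ab.
Qed.

Lemma psf_holomorphic a : polybnd a -> holomorphic (psf a).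
Proof.
move=> pa; split=> z zD; last by rewrite psf_out.
exact: cdiff_derivable (psf_cdiff pa zD).
Qed.

End power_series.

(** * Integrals of complex functions of a real variable *)

Section complex_integral.
Variable R : realType.
Local Notation C := R[i].
Local Notation mu := (@lebesgue_measure R).
Implicit Types (a b c t : R) (g h : R -> C).

Definition ccont a b g := forall t, a <= t <= b -> forall e : R, 0 < e ->
  exists2 d : R, 0 < d &
    forall t', a <= t' <= b -> `|t' - t| < d -> cabs (g t' - g t) <= e.

Lemma ccont_cst a b (k : C) : ccont a b (fun=> k).
Proof. by move=> t _ e e0; exists 1 => // t' _ _; rewrite subrr cabs0 ltW. Qed.

Lemma ccontD a b g h : ccont a b g -> ccont a b h -> ccont a b (fun t => g t + h t).
Proof.
move=> cg ch t tab e e0; have e2 : 0 < e / 2 by lra.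
have [d d0 hd] := cg t tab _ e2; have [d' d'0 hd'] := ch t tab _ e2.
exists (Num.min d d'); first by rewrite lt_min d0.
move=> t' t'ab; rewrite lt_min => /andP[/(hd _ t'ab) h1 /(hd' _ t'ab) h2].
by rewrite opprD addrACA; apply: le_trans (cabsD _ _) _; lra.
Qed.

Lemma ccontM a b g h : ccont a b g -> ccont a b h -> ccont a b (fun t => g t * h t).
Proof.
move=> cg ch t tab e e0.
set A := cabs (g t) + cabs (h t) + 1.
have A1 : 0 < A by have := cabs_ge0 (g t); have := cabs_ge0 (h t); rewrite /A; lra.
(* The 1 makes the product of the two increments at most a single one, so the three error terms add
   up to at most [e / (2 * A) * A]. *)
have e2 : 0 < Num.min 1 (e / (2 * A)) by rewrite lt_min ltr01 divr_gt0// mulr_gt0.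
have [d d0 hd] := cg t tab _ e2; have [d' d'0 hd'] := ch t tab _ e2.
exists (Num.min d d'); first by rewrite lt_min d0.
move=> t' t'ab; rewrite lt_min => /andP[/(hd _ t'ab) h1 /(hd' _ t'ab) h2].
have -> : g t' * h t' - g t * h t = (g t' - g t) * (h t' - h t) +
   (g t' - g t) * h t + g t * (h t' - h t) by ring.
apply: le_trans (cabsD _ _) _; apply: le_trans (lerD (cabsD _ _) (lexx _)) _.
rewrite !cabsM; move: h1 h2; rewrite !le_min => /andP[h1 h3] /andP[h2 h4].
have g0 := cabs_ge0 (g t); have k0 := cabs_ge0 (h t).
have u0 := cabs_ge0 (g t' - g t); have v0 := cabs_ge0 (h t' - h t).
set x := e / (2 * A) in h3 h4.
have xE : x * (2 * A) = e by rewrite /x divfK// gt_eqF// mulr_gt0.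
have x0 : 0 <= x by rewrite /x divr_ge0// ltW// mulr_gt0.
have p1 : cabs (g t' - g t) * cabs (h t' - h t) <= x.
  by apply: le_trans h4; rewrite ler_piMl.
have p2 : cabs (g t' - g t) * cabs (h t) <= x * cabs (h t) by exact: ler_wpM2r.
have p3 : cabs (g t) * cabs (h t' - h t) <= cabs (g t) * x by exact: ler_wpM2l.
by rewrite -xE /A; nra.
Qed.

Lemma ccontX a b g n : ccont a b g -> ccont a b (fun t => g t ^+ n).
Proof.
move=> cg; elim: n => [|n ih]; first by under eq_fun do rewrite expr0; exact: ccont_cst.
by under eq_fun do rewrite exprS; exact: ccontM.
Qed.

Lemma ccontZ a b (k : C) g : ccont a b g -> ccont a b (fun t => k * g t).
Proof. by move=> cg; apply: ccontM cg; exact: ccont_cst. Qed.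

Lemma ccontB a b g h : ccont a b g -> ccont a b h -> ccont a b (fun t => g t - h t).
Proof.
move=> cg ch; have := ccontD cg (ccontZ (-1) ch).
by under eq_fun do rewrite mulN1r.
Qed.

Lemma ccont_sub a b a' b' g : a <= a' -> b' <= b -> ccont a b g -> ccont a' b' g.
Proof.
move=> aa bb cg t /andP[ta tb] e e0.
have [|d d0 hd] := cg t _ e e0; first by rewrite (le_trans aa)//= (le_trans tb).
exists d => // t' /andP[t'a t'b]; apply: hd; by rewrite (le_trans aa)//= (le_trans t'b).
Qed.

Lemma ccont_lip a b g (L : R) :
  (forall t t', a <= t <= b -> a <= t' <= b -> cabs (g t' - g t) <= L * `|t' - t|) ->
  ccont a b g.
Proof.
move=> gL t tab e e0; have L1 : 0 < `|L| + 1 by have := normr_ge0 L; lra.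
exists (e / (`|L| + 1)); first exact: divr_gt0.
move=> t' t'ab; rewrite ltr_pdivlMr// => h; apply: le_trans (gL _ _ tab t'ab) _.
apply: le_trans _ (ltW h); rewrite mulrC; apply: ler_wpM2l => //.
by have := ler_norm L; lra.
Qed.

Lemma ccont_inv a b g (m : R) : 0 < m -> (forall t, a <= t <= b -> m <= cabs (g t)) ->
  ccont a b g -> ccont a b (fun t => (g t)^-1).
Proof.
move=> m0 gm cg t tab e e0.
have em : 0 < e * m ^+ 2 by rewrite mulr_gt0// exprn_gt0.
have [d d0 hd] := cg t tab _ em; exists d => // t' t'ab /(hd _ t'ab) h.
have g0 u : a <= u <= b -> g u != 0.
  by move=> /gm; rewrite -cabs_eq0 => h0; rewrite gt_eqF//; exact: lt_le_trans h0.
have -> : (g t')^-1 - (g t)^-1 = - (g t' - g t) * ((g t')^-1 * (g t)^-1).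
  by field; rewrite !g0.
rewrite !cabsM cabsN !cabsV -invfM ler_pdivrMr; last first.
  by apply: mulr_gt0; apply: lt_le_trans (gm _ _).
apply: le_trans h _; rewrite ler_pM2l// expr2; apply: ler_pM; rewrite ?gm//; lra.
Qed.

Lemma ccont_comp a b g (f : C -> C) : ccont a b g ->
  (forall t, a <= t <= b -> exists d, cdiff f (g t) d) -> ccont a b (fun t => f (g t)).
Proof.
move=> cg fd t tab e e0; have [d /cdiff_cont /(_ _ e0)[r r0 hr]] := fd t tab.
have r2 : 0 < r / 2 by lra.
have [d' d'0 hd'] := cg t tab _ r2; exists d' => // t' t'ab /(hd' _ t'ab) h.
by apply: hr; lra.
Qed.

Lemma ccont_Re a b g : ccont a b g -> {within `[a, b], continuous (fun t => complex.Re (g t))}.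
Proof.
move=> cg; apply/subspace_continuousP => t; rewrite /= in_itv/= => tab.
apply/(@cvgrPdist_le _ R) => e e0; have [d d0 hd] := cg t tab e e0.
rewrite near_withinE; apply/nbhs_ballP; exists d => //= t' td.
rewrite /= in_itv/= => t'ab; rewrite distrC; rewrite /ball/= distrC in td.
by apply: le_trans (hd t' t'ab td); rewrite -raddfB; exact: Re_cabs.
Qed.

Lemma ccont_Im a b g : ccont a b g -> {within `[a, b], continuous (fun t => complex.Im (g t))}.
Proof.
move=> cg; apply/subspace_continuousP => t; rewrite /= in_itv/= => tab.
apply/(@cvgrPdist_le _ R) => e e0; have [d d0 hd] := cg t tab e e0.
rewrite near_withinE; apply/nbhs_ballP; exists d => //= t' td.
rewrite /= in_itv/= => t'ab; rewrite distrC; rewrite /ball/= distrC in td.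
by apply: le_trans (hd t' t'ab td); rewrite -raddfB; exact: Im_cabs.
Qed.

Lemma int_Re a b g : ccont a b g -> mu.-integrable `[a, b] (EFin \o (fun t => complex.Re (g t))).
Proof.
by move=> /ccont_Re; apply: continuous_compact_integrable; exact: segment_compact.
Qed.

Lemma int_Im a b g : ccont a b g -> mu.-integrable `[a, b] (EFin \o (fun t => complex.Im (g t))).
Proof.
by move=> /ccont_Im; apply: continuous_compact_integrable; exact: segment_compact.
Qed.

(** The same expression as in [integration], which makes [integrationE] a mere unfolding. *)
Definition cint a b g : C :=
  (\int[mu]_(t in `[a, b]) complex.Re (g t)) +i* (\int[mu]_(t in `[a, b]) complex.Im (g t)).

Lemma eq_cint a b g h : (forall t, a <= t <= b -> g t = h t) -> cint a b g = cint a b h.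
Proof.
move=> gh; rewrite /cint; congr (_ +i* _); apply: eq_Rintegral => t;
  by move=> /set_mem; rewrite /= in_itv/= => /gh ->.
Qed.

Lemma cintD a b g h : ccont a b g -> ccont a b h ->
  cint a b (fun t => g t + h t) = cint a b g + cint a b h.
Proof.
move=> cg ch; apply/eqP; rewrite eq_complex/=; apply/andP; split; apply/eqP.
  rewrite -RintegralD//; [|exact: int_Re|exact: int_Re].
  by apply: eq_Rintegral => t _; rewrite raddfD.
rewrite -RintegralD//; [|exact: int_Im|exact: int_Im].
by apply: eq_Rintegral => t _; rewrite raddfD.
Qed.

Lemma cintZ a b (k : C) g : ccont a b g -> cint a b (fun t => k * g t) = k * cint a b g.
Proof.
case: k => x y cg; have iR := int_Re cg; have iI := int_Im cg.
have iZ r f : mu.-integrable `[a, b] (EFin \o f) ->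
    mu.-integrable `[a, b] (EFin \o (fun t => r * f t)).
  by move=> intf; have := integrableZl _ r intf; apply.
apply/eqP; rewrite eq_complex/=; apply/andP; split; apply/eqP.
  rewrite -!RintegralZl// -RintegralB//; [|exact: iZ|exact: iZ].
  by apply: eq_Rintegral => t _; case: (g t).
rewrite -!RintegralZl// -RintegralD//; [|exact: iZ|exact: iZ].
by apply: eq_Rintegral => t _; case: (g t).
Qed.

Lemma cintB a b g h : ccont a b g -> ccont a b h ->
  cint a b (fun t => g t - h t) = cint a b g - cint a b h.
Proof.
move=> cg ch; rewrite -mulN1r -cintZ// -cintD//; last exact: ccontZ.
by apply: eq_cint => t _; rewrite mulN1r.
Qed.

Lemma cint_sum a b (n : nat) (G : nat -> R -> C) : (forall i, ccont a b (G i)) ->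
  cint a b (fun t => \sum_(i < n) G i t) = \sum_(i < n) cint a b (G i).
Proof.
move=> cG; have cS m : ccont a b (fun t => \sum_(i < m) G i t).
  elim: m => [|m ih]; first by under eq_fun do rewrite big_ord0; exact: ccont_cst.
  by under eq_fun do rewrite big_ord_recr/=; exact: ccontD.
elim: n => [|n ih].
  transitivity (0 * cint a b (fun=> 0)); last by rewrite mul0r big_ord0.
  rewrite -cintZ; last exact: ccont_cst.
  by apply: eq_cint => t _; rewrite big_ord0 mul0r.
rewrite big_ord_recr/= -ih -cintD//.
by apply: eq_cint => t _; rewrite big_ord_recr.
Qed.

Lemma cint_split a c b g : a <= c <= b -> ccont a b g ->
  cint a b g = cint a c g + cint c b g.
Proof.
move=> /andP[ac cb] cg; have cg' : ccont c b g by exact: ccont_sub cg.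
have sp f : mu.-integrable `[a, b] (EFin \o f) ->
  \int[mu]_(t in `[a, b]) f t = \int[mu]_(t in `[a, c]) f t + \int[mu]_(t in `[c, b]) f t.
  move=> intf; rewrite -(@Rintegral_itv_obnd_cbnd _ c (BRight b)).
    by rewrite -(Rintegral_itvB intf) ?bnd_simp// addrC subrK.
  apply: integrableS intf => //; apply: subset_itvr; by rewrite bnd_simp.
apply/eqP; rewrite eq_complex/=; apply/andP; split; apply/eqP.
  exact/sp/int_Re.
exact/sp/int_Im.
Qed.

Lemma Rint_cst a b (r : R) : a <= b -> \int[mu]_(t in `[a, b]) r = (b - a) * r.
Proof.
move=> ab; rewrite Rintegral_cst//.
rewrite (_ : fine _ = b - a) 1?mulrC//.
have := @lebesgue_measure_itv R `[a, b]; rewrite /= lte_fin => ->.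
by case: ltP => [//|ba]; apply/eqP; rewrite /= eq_sym subr_eq0 eq_le ba ab.
Qed.

Lemma Rint_le a b (f : R -> R) (M : R) : a <= b -> mu.-integrable `[a, b] (EFin \o f) ->
  (forall t, a <= t <= b -> `|f t| <= M) -> `|\int[mu]_(t in `[a, b]) f t| <= (b - a) * M.
Proof.
move=> ab intf fM; apply: le_trans (le_normr_Rintegral _ intf) _ => //.
have M_int : mu.-integrable `[a, b] (EFin \o (fun=> M)).
  apply: continuous_compact_integrable; first exact: segment_compact.
  by apply: continuous_subspaceT => x; exact: cvg_cst.
rewrite -Rint_cst//; apply: le_Rintegral => //.
by have := integrable_abse intf.
Qed.

(* The factor [2] comes from bounding real and imaginary parts separately. *)
Lemma cint_le a b g (M : R) : a <= b -> ccont a b g ->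
  (forall t, a <= t <= b -> cabs (g t) <= M) -> cabs (cint a b g) <= 2 * ((b - a) * M).
Proof.
move=> ab cg gM; apply: le_trans (cabs_ReIm _) _ => /=.
have := @Rint_le a b _ M ab (int_Re cg).
have := @Rint_le a b _ M ab (int_Im cg).
move=> h1 h2; rewrite mulr_natl mulr2n; apply: lerD.
  by apply: h2 => t /gM; apply: le_trans; exact: Re_cabs.
by apply: h1 => t /gM; apply: le_trans; exact: Im_cabs.
Qed.

Lemma cint_close a b g h (M : R) : a <= b -> ccont a b g -> ccont a b h ->
  (forall t, a <= t <= b -> cabs (g t - h t) <= M) ->
  cabs (cint a b g - cint a b h) <= 2 * ((b - a) * M).
Proof.
by move=> ab cg ch ghM; rewrite -cintB//; apply: cint_le => //; exact: ccontB.
Qed.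

Lemma cint_cst a b (k : C) : a <= b -> cint a b (fun=> k) = (b - a)%:C * k.
Proof.
by move=> ab; case: k => x y; rewrite /cint/= !Rint_cst//; apply/eqP; rewrite eq_complex/= !mul0r subr0 addr0 !eqxx.
Qed.

(** Two-sided even at the ends of an interval of integration: the primitives used below are defined
    and differentiable beyond it. *)
Definition rdiff g t (d : C) := forall e : R, 0 < e -> exists2 r : R, 0 < r &
  forall t', `|t' - t| < r -> cabs (g t' - g t - (t' - t)%:C * d) <= e * `|t' - t|.

Lemma real_diff (F : R -> R) t (d : R) :
  (forall e : R, 0 < e -> exists2 r : R, 0 < r &
    forall t', `|t' - t| < r -> `|F t' - F t - (t' - t) * d| <= e * `|t' - t|) ->
  derivable F t 1 /\ derive1 F t = d.
Proof.
move=> Fd.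
have h : (fun h : R => h^-1 *: (F (h *: 1 + t) - F t)) @ 0^' --> d.
  apply/(@cvgrPdist_le _ R) => e e0; have [r r0 hr] := Fd e e0.
  rewrite /dnbhs near_withinE; apply/nbhs_ballP; exists r => //= u.
  rewrite /ball/= sub0r normrN => ur u0; rewrite /GRing.scale/= mulr1.
  have := hr (u + t); rewrite addrK => /(_ ur).
  have -> : d - u^-1 * (F (u + t) - F t) = - (u^-1 * (F (u + t) - F t - u * d)) by field.
  by move=> h; rewrite normrN normrM normfV [_^-1 * _]mulrC ler_pdivrMr ?normr_gt0.
split; first by apply/cvg_ex; exists d.
by rewrite derive1E /derive; apply: cvg_lim.
Qed.

Lemma real_FTC (f F : R -> R) a b : a < b -> {within `[a, b], continuous f} ->
  (forall t, a <= t <= b -> derivable F t 1 /\ derive1 F t = f t) ->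
  \int[mu]_(t in `[a, b]) f t = F b - F a.
Proof.
move=> ab cf Fd; rewrite /Rintegral (@continuous_FTC2 _ _ F)//.
  have Fc t : a <= t <= b -> {for t, continuous F}.
    by move=> /Fd[/derivable1_diffP dF _]; exact: differentiable_continuous.
  split.
  - by move=> t; rewrite in_itv/= => /andP[/ltW ta /ltW tb]; apply: (Fd t _).1; rewrite ta.
  - by apply: cvg_at_right_filter; apply: Fc; rewrite lexx ltW.
  - by apply: cvg_at_left_filter; apply: Fc; rewrite lexx ltW.
by move=> t; rewrite in_itv/= => /andP[/ltW ta /ltW tb]; apply: (Fd t _).2; rewrite ta.
Qed.

Lemma cint_FTC a b (G g : R -> C) : a <= b -> ccont a b g ->
  (forall t, a <= t <= b -> rdiff G t (g t)) -> cint a b g = G b - G a.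
Proof.
move=> ab cg Gg; move: ab; rewrite le_eqVlt => /predU1P[ab|ab].
  by rewrite -ab /cint set_itv1 !Rintegral_set1 subrr.
apply/eqP; rewrite eq_complex !raddfB/=; apply/andP; split; apply/eqP.
  apply: (@real_FTC _ (fun t => complex.Re (G t))) => //; first exact: ccont_Re.
  move=> t tab; apply: real_diff => e e0; have [r r0 hr] := Gg t tab e e0.
  exists r => // t' /hr; apply: le_trans; apply: le_trans (Re_cabs _).
  by case: (G t') (G t) (g t) => ? ? [? ?] [? ?]; rewrite /= mul0r subr0.
apply: (@real_FTC _ (fun t => complex.Im (G t))) => //; first exact: ccont_Im.
move=> t tab; apply: real_diff => e e0; have [r r0 hr] := Gg t tab e e0.
exists r => // t' /hr; apply: le_trans; apply: le_trans (Im_cabs _).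
by case: (G t') (G t) (g t) => ? ? [? ?] [? ?]; rewrite /= mul0r addr0.
Qed.

End complex_integral.

(** * The parametrization e^(it) of the unit circle *)

Section circle.
Variable R : realType.
Local Notation C := R[i].
Implicit Types t : R.

Definition ecis t : C := cos t +i* sin t.

Lemma ecisD s t : ecis (s + t) = ecis s * ecis t.
Proof.
apply/eqP; rewrite eq_complex /ecis/= sinD cosD eqxx/=.
by apply/eqP; ring.
Qed.

Lemma ecis0 : ecis 0 = 1.
Proof. by rewrite /ecis sin0 cos0. Qed.

Lemma ecis2pi : ecis (pi *+ 2) = 1.
Proof. by rewrite /ecis sin2pi cos2pi. Qed.

Lemma ecisN t : ecis (- t) = (ecis t)^-1.
Proof.
have h : ecis (- t) * ecis t = 1 by rewrite -ecisD addNr ecis0.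
have t0 : ecis t != 0 by apply/eqP => t0; move/eqP: h; rewrite t0 mulr0 eq_sym oner_eq0.
by apply: (mulIf t0); rewrite h mulVf.
Qed.

Lemma ecisX t n : ecis t ^+ n = ecis (n%:R * t).
Proof.
elim: n => [|n ih]; first by rewrite expr0 mul0r ecis0.
by rewrite exprS ih -ecisD -[in RHS]natr1 mulrDl mul1r addrC.
Qed.

Lemma cabs_ecis t : cabs (ecis t) = 1.
Proof. by rewrite /cabs normc_def/= cos2Dsin2 sqrtr1. Qed.

Lemma real_diffE (F : R -> R) t (d : R) : is_derive t 1 F d ->
  forall e : R, 0 < e -> exists2 r : R, 0 < r &
    forall t', `|t' - t| < r -> `|F t' - F t - (t' - t) * d| <= e * `|t' - t|.
Proof.
move=> [/cvg_ex[l Fl] Fd] e e0; move: Fd; rewrite /derive (cvg_lim _ Fl)// => ld.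
move: Fl; rewrite {l}ld => /(@cvgrPdist_le _ R) /(_ e e0).
rewrite /dnbhs near_withinE => /nbhs_ballP[r r0 hr]; exists r => // t' tr.
have [->|tt] := eqVneq t' t; first by rewrite !subrr mul0r subrr normr0 mulr0.
have tt0 : t' - t != 0 by rewrite subr_eq0.
have := hr (t' - t); rewrite /ball/= sub0r normrN => /(_ tr tt0).
rewrite /GRing.scale/= mulr1 subrK.
have -> : d - (t' - t)^-1 * (F t' - F t) = - ((t' - t)^-1 * (F t' - F t - (t' - t) * d)).
  by field.
by rewrite normrN normrM normfV [_^-1 * _]mulrC ler_pdivrMr ?normr_gt0.
Qed.

Lemma rdiff_ecis t : rdiff ecis t ('i%C * ecis t).
Proof.
move=> e e0; have e2 : 0 < e / 2 by lra.
have [r r0 hr] := real_diffE (is_derive_cos t) e2.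
have [q q0 hq] := real_diffE (is_derive_sin t) e2.
exists (Num.min r q); first by rewrite lt_min r0.
move=> t'; rewrite lt_min => /andP[/hr h1 /hq h2].
apply: le_trans (cabs_ReIm _) _ => /=.
have -> : (cos t' - cos t - ((t' - t) * (0 * cos t - 1 * sin t) -
    0 * (0 * sin t + 1 * cos t))) = cos t' - cos t - (t' - t) * - sin t by ring.
have -> : sin t' - sin t - ((t' - t) * (0 * sin t + 1 * cos t) +
    0 * (0 * cos t - 1 * sin t)) = sin t' - sin t - (t' - t) * cos t by ring.
lra.
Qed.

Lemma rdiffZ (k : C) (g : R -> C) t d : rdiff g t d -> rdiff (fun t => k * g t) t (k * d).
Proof.
move=> gd e e0; have k0 : 0 < 1 + cabs k by have := cabs_ge0 k; lra.
have [r r0 hr] := gd _ (divr_gt0 e0 k0); exists r => // t' /hr.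
rewrite [_%:C * (k * d)]mulrCA -!mulrBr cabsM mulrAC ler_pdivlMr// => h.
apply: le_trans h; rewrite mulrC; apply: ler_wpM2l; first exact: cabs_ge0.
lra.
Qed.

Lemma rdiff_lin (c : R) (g : R -> C) t d : rdiff g (c * t) d ->
  rdiff (fun t => g (c * t)) t (c%:C * d).
Proof.
move=> gd e e0; have c0 : 0 < 1 + `|c| by have := normr_ge0 c; lra.
have [r r0 hr] := gd _ (divr_gt0 e0 c0); exists (r / (1 + `|c|)); first exact: divr_gt0.
move=> t'; rewrite ltr_pdivlMr// => h; have n0 := normr_ge0 (t' - t).
have h1 : `|c * t' - c * t| <= (1 + `|c|) * `|t' - t|.
  by rewrite -mulrBr normrM; apply: ler_wpM2r => //; lra.
have h2 : `|c * t' - c * t| < r by lra.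
have -> : (t' - t)%:C * (c%:C * d) = (c * t' - c * t)%:C * d.
  by rewrite mulrA -rmorphM/=; congr (_%:C * d); ring.
apply: le_trans (hr _ h2) _; rewrite mulrAC ler_pdivrMr// -mulrA.
by rewrite ler_pM2l// [in leRHS]mulrC.
Qed.

Lemma rdiff_ccont a b (g g' : R -> C) : (forall t, a <= t <= b -> rdiff g t (g' t)) ->
  ccont a b g.
Proof.
move=> gd t /gd gt e e0; have [r r0 hr] := gt 1 ltr01.
have k0 : 0 < 1 + cabs (g' t) by have := cabs_ge0 (g' t); lra.
exists (Num.min r (e / (1 + cabs (g' t)))); first by rewrite lt_min r0 divr_gt0.
move=> t' _; rewrite lt_min ltr_pdivlMr// => /andP[/hr h1 h2].
rewrite -[g t' - g t](subrK ((t' - t)%:C * g' t)).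
apply: le_trans (cabsD _ _) _; rewrite cabsM cabs_real; lra.
Qed.

Lemma ccont_ecis a b : ccont a b ecis.
Proof. by apply: rdiff_ccont => t _; exact: rdiff_ecis. Qed.

Lemma ccont_ecis_lin a b c : ccont a b (fun t => ecis (c * t)).
Proof. by apply: rdiff_ccont => t _; apply: rdiff_lin; exact: rdiff_ecis. Qed.

Lemma cint_iecis a b : a <= b -> cint a b (fun t => 'i%C * ecis t) = ecis b - ecis a.
Proof.
move=> ab; apply: cint_FTC => //; first exact/ccontZ/ccont_ecis.
by move=> t _; exact: rdiff_ecis.
Qed.

(** The increment is the integral of ['i%C * ecis]; the 2 is inherited from [cint_le]. *)
Lemma ecis_lip s t : cabs (ecis s - ecis t) <= 2 * `|s - t|.
Proof.
wlog ts : s t / t <= s.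
  by move=> h; case: (leP t s) => [/h//|/ltW/h]; rewrite cabsB distrC.
rewrite -cint_iecis// ger0_norm ?subr_ge0// -[s - t]mulr1.
apply: cint_le => //; first exact/ccontZ/ccont_ecis.
by move=> u _; rewrite cabsM cabs_ecis cabs_i mulr1.
Qed.

Lemma cint_ecis_pow n : (0 < n)%N -> cint 0 (pi *+ 2) (fun t => ecis (- n%:R * t)) = 0.
Proof.
move=> n0; have nR : (n%:R : R) != 0 by rewrite pnatr_eq0 -lt0n.
(* With k = i/n, the function k e^(-int) is a periodic primitive of e^(-int). *)
set k : C := 'i%C * (n%:R^-1)%:C.
rewrite (@cint_FTC _ _ _ (fun t => k * ecis (- n%:R * t))).
- by rewrite mulr0 ecis0 mulNr ecisN -ecisX ecis2pi expr1n invr1 subrr.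
- by rewrite mulrn_wge0// pi_ge0.
- exact: ccont_ecis_lin.
move=> t _; have := rdiffZ k (rdiff_lin (@rdiff_ecis (- n%:R * t))).
rewrite /k; set e := ecis _ => h.
suff <- : 'i%C * (n%:R^-1)%:C * ((- n%:R)%:C * ('i%C * e)) = e by [].
have hn : (n%:R^-1)%:C * (- n%:R)%:C = -1 :> C by rewrite -rmorphM/= mulrN mulVf// rmorphN1.
have ii : 'i%C * 'i%C = -1 :> C by rewrite -expr2 sqr_i.
transitivity ('i%C * 'i%C * ((n%:R^-1)%:C * (- n%:R)%:C) * e); first by ring.
by rewrite hn ii; ring.
Qed.

End circle.

(** * Cauchy's formula *)

Section bisection.
Variable R : realType.
Local Notation C := R[i].

Lemma nested_intervals (s : nat -> R) (h : R) : 0 <= h ->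
  (forall n, s n <= s n.+1 /\ s n.+1 + h / 2 ^+ n.+1 <= s n + h / 2 ^+ n) ->
  exists x, forall n, s n <= x <= s n + h / 2 ^+ n.
Proof.
move=> h0 hs; have hp n : 0 <= h / 2 ^+ n by rewrite divr_ge0// exprn_ge0.
have s_mono m n : s m <= s (m + n)%N.
  by elim: n => [|n ih]; rewrite ?addn0// addnS; apply: le_trans ih _; case: (hs (m + n)%N).
have u_mono m n : s (m + n)%N + h / 2 ^+ (m + n) <= s m + h / 2 ^+ m.
  by elim: n => [|n ih]; rewrite ?addn0// addnS; apply: le_trans ih; case: (hs (m + n)%N).
have ub n m : s m <= s n + h / 2 ^+ n.
  case/orP: (leq_total m n) => /subnKC <-.
    by apply: le_trans (s_mono m (n - m)%N) _; rewrite lerDl.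
  by apply: le_trans (u_mono n (m - n)%N); rewrite lerDl.
have hasub : has_sup (range s).
  by split; [exists (s 0); exists 0%N|exists (s 0 + h / 2 ^+ 0) => _ [m _ <-]].
exists (sup (range s)) => n; apply/andP; split.
  by apply: sup_upper_bound => //; exists n.
by apply: ge_sup; [exists (s 0); exists 0%N|move=> _ [m _ <-]].
Qed.

Variables (S1 S2 T1 T2 : R) (L : R -> R -> R -> R -> C).
Hypotheses (S12 : S1 <= S2) (T12 : T1 <= T2).
Hypothesis L_split_s : forall s1 m s2 t1 t2, S1 <= s1 -> s1 <= m -> m <= s2 -> s2 <= S2 ->
  T1 <= t1 -> t1 <= t2 -> t2 <= T2 -> L s1 s2 t1 t2 = L s1 m t1 t2 + L m s2 t1 t2.
Hypothesis L_split_t : forall s1 s2 t1 m t2, S1 <= s1 -> s1 <= s2 -> s2 <= S2 ->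
  T1 <= t1 -> t1 <= m -> m <= t2 -> t2 <= T2 -> L s1 s2 t1 t2 = L s1 s2 t1 m + L s1 s2 m t2.
Hypothesis L_local : forall s t, S1 <= s <= S2 -> T1 <= t <= T2 -> forall e : R, 0 < e ->
  exists2 d : R, 0 < d & forall s1 s2 t1 t2, S1 <= s1 -> s1 <= s <= s2 -> s2 <= S2 ->
    T1 <= t1 -> t1 <= t <= t2 -> t2 <= T2 -> s2 - s1 < d -> t2 - t1 < d ->
    cabs (L s1 s2 t1 t2) <= e * ((s2 - s1) + (t2 - t1)) ^+ 2.

Let h := S2 - S1.
Let k := T2 - T1.

(** Invariant of the bisection: the level [n] rectangle with lower corner [p] lies in the original
    one and retains at least [c / 4 ^+ n] of the modulus. *)
Let big c n (p : R * R) := [/\ S1 <= p.1, p.1 + h / 2 ^+ n <= S2, T1 <= p.2,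
  p.2 + k / 2 ^+ n <= T2 &
  c <= 4 ^+ n * cabs (L p.1 (p.1 + h / 2 ^+ n) p.2 (p.2 + k / 2 ^+ n))].

Let half_step (x : R) n : x / 2 ^+ n = x / 2 ^+ n.+1 + x / 2 ^+ n.+1.
Proof. by rewrite exprS; field; rewrite expf_neq0. Qed.

Let big_step c n p : big c n p -> exists q, [/\ big c n.+1 q,
  p.1 <= q.1 /\ q.1 + h / 2 ^+ n.+1 <= p.1 + h / 2 ^+ n &
  p.2 <= q.2 /\ q.2 + k / 2 ^+ n.+1 <= p.2 + k / 2 ^+ n].
Proof.
case: p => s t [/= Ss sS Tt tT cL].
have h0 : 0 <= h / 2 ^+ n.+1 by rewrite divr_ge0 ?subr_ge0// exprn_ge0.
have k0 : 0 <= k / 2 ^+ n.+1 by rewrite divr_ge0 ?subr_ge0// exprn_ge0.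
move: cL sS tT; rewrite (half_step h) (half_step k) !addrA.
set x := h / _ in h0 *; set y := k / _ in k0 * => cL sS tT.
have LE : L s (s + x + x) t (t + y + y) = L s (s + x) t (t + y) + L s (s + x) (t + y) (t + y + y) +
    (L (s + x) (s + x + x) t (t + y) + L (s + x) (s + x + x) (t + y) (t + y + y)).
  have e1 : L s (s + x + x) t (t + y + y) =
      L s (s + x) t (t + y + y) + L (s + x) (s + x + x) t (t + y + y).
    by apply: L_split_s; lra.
  have e2 : L s (s + x) t (t + y + y) = L s (s + x) t (t + y) + L s (s + x) (t + y) (t + y + y).
    by apply: L_split_t; lra.
  have e3 : L (s + x) (s + x + x) t (t + y + y) =
      L (s + x) (s + x + x) t (t + y) + L (s + x) (s + x + x) (t + y) (t + y + y).
    by apply: L_split_t; lra.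
  by rewrite e1 e2 e3.
set A := L s (s + x) t (t + y) in LE.
set B := L s (s + x) (t + y) (t + y + y) in LE.
set D := L (s + x) (s + x + x) t (t + y) in LE.
set E := L (s + x) (s + x + x) (t + y) (t + y + y) in LE.
have {}cL : c <= 4 ^+ n.+1 * (cabs A + cabs B + (cabs D + cabs E)) / 4.
  apply: le_trans cL _; rewrite LE exprS.
  have := cabsD (A + B) (D + E); have := cabsD A B; have := cabsD D E => h1 h2 h3.
  have p4 : 0 <= 4 ^+ n :> R by rewrite exprn_ge0.
  have : cabs (A + B + (D + E)) <= cabs A + cabs B + (cabs D + cabs E) by lra.
  by move=> /(ler_wpM2l p4); lra.
have [cA|cA] := leP c (4 ^+ n.+1 * cabs A).
  by exists (s, t); split=> /=; [rewrite /big /= -/x -/y; split=> //; lra|split; lra..].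
have [cB|cB] := leP c (4 ^+ n.+1 * cabs B).
  by exists (s, t + y); split=> /=; [rewrite /big /= -/x -/y; split=> //; lra|split; lra..].
have [cD|cD] := leP c (4 ^+ n.+1 * cabs D).
  by exists (s + x, t); split=> /=; [rewrite /big /= -/x -/y; split=> //; lra|split; lra..].
have [cE|cE] := leP c (4 ^+ n.+1 * cabs E).
  by exists (s + x, t + y); split=> /=; [rewrite /big /= -/x -/y; split=> //; lra|split; lra..].
lra.
Qed.

(** Goursat's argument for an additive function of rectangles that is locally o(size^2): at the
    common point of the nested rectangles the local bound contradicts the lower bound
    [c / 4 ^+ n]. *)
Lemma bisection_eq0 : L S1 S2 T1 T2 = 0.
Proof.
apply/eqP/negPn/negP; rewrite -cabs_eq0 => L0.
set c := cabs (L S1 S2 T1 T2) in L0; have c0 : 0 < c by rewrite lt_def L0 cabs_ge0.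
have h0 : 0 <= h by rewrite subr_ge0.
have k0 : 0 <= k by rewrite subr_ge0.
(* The default [p] is harmless: [big_step] shows that a suitable quarter exists at every stage
   reached. *)
pose next n (p : R * R) := xget p [set q | [/\ big c n.+1 q,
  p.1 <= q.1 /\ q.1 + h / 2 ^+ n.+1 <= p.1 + h / 2 ^+ n &
  p.2 <= q.2 /\ q.2 + k / 2 ^+ n.+1 <= p.2 + k / 2 ^+ n]].
pose fix x n := if n is m.+1 then next m (x m) else (S1, T1).
have bx n : big c n (x n).
  elim: n => [|n ih].
    have e0 (u v : R) : u + (v - u) = v by lra.
    by rewrite /big/= !expr0 !divr1 mul1r /h /k !e0.
  by have [] := xgetPex (x n) (big_step ih).
have nx n : (x n).1 <= (x n.+1).1 /\ (x n.+1).1 + h / 2 ^+ n.+1 <= (x n).1 + h / 2 ^+ n.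
  by have [] := xgetPex (x n) (big_step (bx n)).
have ny n : (x n).2 <= (x n.+1).2 /\ (x n.+1).2 + k / 2 ^+ n.+1 <= (x n).2 + k / 2 ^+ n.
  by have [] := xgetPex (x n) (big_step (bx n)).
have [s hs] := nested_intervals h0 nx; have [t ht] := nested_intervals k0 ny.
have sS : S1 <= s <= S2.
  by have := hs 0%N; rewrite /= expr0 divr1 /h => /andP[-> sS]; rewrite /=; lra.
have tT : T1 <= t <= T2.
  by have := ht 0%N; rewrite /= expr0 divr1 /k => /andP[-> tT]; rewrite /=; lra.
(* Taking [e = c / A] gives [c / A * (h + k) ^+ 2 < c]; the added 1 makes this strict and covers
   degenerate rectangles. *)
set A := (h + k) ^+ 2 + 1; have A0 : 0 < A by rewrite ltr_wpDl// sqr_ge0.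
have [d d0 hd] := L_local sS tT (divr_gt0 c0 A0).
have [n hn] : exists n, (h + k) / 2 ^+ n < d.
  have [n hn] : exists n : nat, (h + k) / d < n%:R.
    by exists (Num.truncn ((h + k) / d)).+1; exact: truncnS_gt.
  exists n; rewrite ltr_pdivrMr ?exprn_gt0// mulrC -ltr_pdivrMr//.
  apply: lt_trans hn _; rewrite -natrX ltr_nat; exact: ltn_expl.
have [b1 b2 b3 b4 b5] := bx n.
have p2 : 0 < 2 ^+ n :> R by rewrite exprn_gt0.
have hdn : h / 2 ^+ n <= (h + k) / 2 ^+ n by rewrite ler_pM2r ?invr_gt0//; lra.
have kdn : k / 2 ^+ n <= (h + k) / 2 ^+ n by rewrite ler_pM2r ?invr_gt0//; lra.
have := hd _ _ _ _ b1 (hs n) b2 b3 (ht n) b4.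
have addK (u v : R) : u + v - u = v by lra.
rewrite !addK => hL; have {}hL := hL (le_lt_trans hdn hn) (le_lt_trans kdn hn).
have p4 : 0 <= 4 ^+ n :> R by rewrite exprn_ge0.
have := le_trans b5 (ler_wpM2l p4 hL).
have -> : 4 ^+ n * (c / A * (h / 2 ^+ n + k / 2 ^+ n) ^+ 2) = c / A * (h + k) ^+ 2.
  have -> : 4 ^+ n = 2 ^+ n * 2 ^+ n :> R by rewrite -exprMn; congr (_ ^+ n); lra.
  by field; rewrite !gt_eqF.
rewrite mulrAC ler_pdivlMr// ler_pM2l// /A; lra.
Qed.

End bisection.

(** * Cauchy's formula and Taylor coefficients on a circle *)

Section cauchy.
Variable R : realType.
Local Notation C := R[i].
Variables (f : C -> C) (r : R) (z0 : C).
Hypothesis (df : forall z, cabs z < 1 -> exists d, cdiff f z d).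
Hypotheses (r1 : r < 1) (z0r : cabs z0 < r).
Implicit Types s t : R.

Let circ t : C := r%:C * ecis t.
Let H s t : C := z0 + s%:C * (circ t - z0).
Let kap t : C := circ t / (circ t - z0).
Let K := (r - cabs z0)^-1.

Let r0 : 0 < r. Proof. by apply: le_lt_trans z0r; exact: cabs_ge0. Qed.
Let K0 : 0 < K. Proof. by rewrite invr_gt0 subr_gt0. Qed.

Let cabs_circ t : cabs (circ t) = r.
Proof. by rewrite cabsM cabs_ecis mulr1 cabs_real gtr0_norm. Qed.

Let circ_dist t : r - cabs z0 <= cabs (circ t - z0).
Proof.
have := cabs_dist (circ t) z0; rewrite cabs_circ; apply: le_trans; exact: ler_norm.
Qed.

Let circ_neq t : circ t - z0 != 0.
Proof. by rewrite -cabs_eq0 gt_eqF//; apply: lt_le_trans (circ_dist t); rewrite subr_gt0. Qed.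

Let circ_dist2 t : cabs (circ t - z0) <= 2.
Proof.
by have := cabsD (circ t) (- z0); rewrite cabsN cabs_circ; have := z0r; have := r1; lra.
Qed.

Let cabs_kap t : cabs (kap t) <= K.
Proof.
rewrite cabsM cabsV cabs_circ -[leRHS]mul1r; apply: ler_pM.
- exact: ltW r0.
- by rewrite invr_ge0 cabs_ge0.
- exact: ltW.
by rewrite lef_pV2 ?circ_dist// posrE ?subr_gt0//; apply: lt_le_trans (circ_dist t);
  rewrite subr_gt0.
Qed.

Let cabs_H s t : 0 <= s <= 1 -> cabs (H s t) < 1.
Proof.
move=> /andP[s0 s1]; apply: le_lt_trans r1.
have -> : H s t = (1 - s)%:C * z0 + s%:C * circ t.
  by rewrite /H rmorphB rmorph1; ring.
apply: le_trans (cabsD _ _) _.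
rewrite [cabs (_ * z0)]cabsM [cabs (_ * circ t)]cabsM !cabs_real cabs_circ !ger0_norm ?subr_ge0//.
have h0 : 0 <= 1 - s by lra.
by have := ler_wpM2l h0 (ltW z0r); lra.
Qed.

(** The first 2 bounds [circ t - z0], the second is the Lipschitz constant of [ecis], with
    [s' * r <= 1] absorbed. *)
Let H_lip s t s' t' : 0 <= s' <= 1 ->
  cabs (H s t - H s' t') <= 2 * `|s - s'| + 2 * `|t - t'|.
Proof.
move=> /andP[s0 s1].
have -> : H s t - H s' t' = (s - s')%:C * (circ t - z0) + s'%:C * r%:C * (ecis t - ecis t').
  by rewrite /H /circ rmorphB/=; ring.
apply: le_trans (cabsD _ _) _; rewrite !cabsM !cabs_real; apply: lerD.
  by rewrite mulrC; apply: ler_wpM2r.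
rewrite -[leRHS]mul1r; apply: ler_pM (ecis_lip _ _); rewrite ?mulr_ge0 ?cabs_ge0//.
by rewrite (ger0_norm s0) (gtr0_norm r0) mulr_ile1// ltW.
Qed.

Let ccont_circ a b : ccont a b circ.
Proof. exact/ccontZ/ccont_ecis. Qed.

Let ccont_kap a b : ccont a b kap.
Proof.
apply: ccontM; first exact: ccont_circ.
apply: (@ccont_inv _ _ _ _ (r - cabs z0)); first by rewrite subr_gt0.
  by move=> t _.
by apply: ccontB; [exact: ccont_circ|exact: ccont_cst].
Qed.

Let ccont_Ht a b s : 0 <= s <= 1 -> ccont a b (H s).
Proof.
move=> s01; apply: (@ccont_lip _ _ _ _ 2) => t t' _ _.
by apply: le_trans (H_lip _ _ _ s01) _; rewrite subrr normr0 mulr0 add0r.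
Qed.

Let ccont_Hs a b t : 0 <= a -> b <= 1 -> ccont a b (H^~ t).
Proof.
move=> a0 b1; apply: (@ccont_lip _ _ _ _ 2) => s s' /andP[sa sb] _.
have s01 : 0 <= s <= 1 by rewrite (le_trans a0 sa) (le_trans sb).
by apply: le_trans (H_lip _ _ _ s01) _; rewrite subrr normr0 mulr0 addr0.
Qed.

Let ccont_fHt a b s : 0 <= s <= 1 -> ccont a b (fun t => f (H s t)).
Proof.
by move=> s01; apply: ccont_comp; [exact: ccont_Ht|move=> t _; apply: df; exact: cabs_H].
Qed.

Let ccont_fHs a b t : 0 <= a -> b <= 1 -> ccont a b (fun s => f (H s t)).
Proof.
move=> a0 b1; apply: ccont_comp; first exact: ccont_Hs.
move=> s /andP[sa sb]; apply/df/cabs_H.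
by rewrite (le_trans a0 sa) (le_trans sb).
Qed.

Let ccont_sinv a b : 0 < a -> ccont a b (fun s => (s%:C)^-1 : C).
Proof.
move=> a0; apply: (@ccont_inv _ _ _ (fun s => s%:C) a) => //.
  by move=> s /andP[sa _]; rewrite cabs_real; apply: le_trans (ler_norm _).
apply: (@ccont_lip _ _ _ _ 1) => s s' _ _; by rewrite -rmorphB/= cabs_real mul1r.
Qed.

(* Since [dH/dt = 'i s circ] and [dH/ds = circ - z0], the form [dz / (z - z0)]
   pulls back along [H] to ['i kap dt + ds / s]; so [Lam] is the integral of
   [f(z) dz / (z - z0)] along the boundary of the image of a rectangle. For an
   affine [f] it vanishes by inspection, and Goursat's bisection does the rest. *)
Let It s1 s2 t1 t2 := cint t1 t2 (fun t => (f (H s2 t) - f (H s1 t)) * kap t).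
Let Is s1 s2 t1 t2 := cint s1 s2 (fun s => (f (H s t2) - f (H s t1)) * (s%:C)^-1).
Let Lam s1 s2 t1 t2 := 'i%C * It s1 s2 t1 t2 - Is s1 s2 t1 t2.

Let ccont_It a b s1 s2 : 0 <= s1 <= 1 -> 0 <= s2 <= 1 ->
  ccont a b (fun t => (f (H s2 t) - f (H s1 t)) * kap t).
Proof. by move=> s1i s2i; apply: ccontM => //; apply: ccontB; exact: ccont_fHt. Qed.

Let ccont_Is a b t1 t2 : 0 < a -> b <= 1 ->
  ccont a b (fun s => (f (H s t2) - f (H s t1)) * (s%:C)^-1).
Proof.
move=> a0 b1; apply: ccontM; last exact: ccont_sinv.
by apply: ccontB; apply: ccont_fHs => //; exact: ltW.
Qed.

(** The form ds/s is singular at s = 0, so rectangles stay in s >= [S1] > 0; only [cauchy_kernel]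
    lets the lower edge tend to 0. *)
Let Lam_split_s (S1 : R) s1 m s2 t1 t2 : 0 < S1 -> S1 <= s1 -> s1 <= m -> m <= s2 -> s2 <= 1 ->
  Lam s1 s2 t1 t2 = Lam s1 m t1 t2 + Lam m s2 t1 t2.
Proof.
move=> S0 Ss sm ms s2l; have s10 : 0 < s1 by exact: lt_le_trans Ss.
have hs1 : 0 <= s1 <= 1 by lra.
have hm : 0 <= m <= 1 by lra.
have hs2 : 0 <= s2 <= 1 by lra.
rewrite /Lam {1}/Is (@cint_split _ _ m); [|by rewrite sm|exact: ccont_Is].
rewrite -/(Is s1 m t1 t2) -/(Is m s2 t1 t2).
suff -> : It s1 s2 t1 t2 = It s1 m t1 t2 + It m s2 t1 t2 by ring.
rewrite /It -cintD; [|exact: ccont_It..].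
by apply: eq_cint => t _; ring.
Qed.

Let Lam_split_t (S1 : R) s1 s2 t1 m t2 : 0 < S1 -> S1 <= s1 -> s1 <= s2 -> s2 <= 1 ->
  t1 <= m -> m <= t2 -> Lam s1 s2 t1 t2 = Lam s1 s2 t1 m + Lam s1 s2 m t2.
Proof.
move=> S0 Ss s12 s2l tm mt; have s10 : 0 < s1 by exact: lt_le_trans Ss.
have hs1 : 0 <= s1 <= 1 by lra.
have hs2 : 0 <= s2 <= 1 by lra.
rewrite /Lam {1}/It (@cint_split _ _ m); [|by rewrite tm|exact: ccont_It].
rewrite -/(It s1 s2 t1 m) -/(It s1 s2 m t2).
suff -> : Is s1 s2 t1 t2 = Is s1 s2 t1 m + Is s1 s2 m t2 by ring.
rewrite /Is -cintD; [|exact: ccont_Is..].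
by apply: eq_cint => s _; ring.
Qed.

(** In the difference [c] and [z0] drop out, and [circ t - z0] cancels the denominator of [kap],
    leaving a multiple of the derivative of [circ]. [Lam_affine_s] has the same value because there
    the factor s cancels, so [Lam] vanishes on affine functions. *)
Let Lam_affine_t s1 s2 t1 t2 (d c : C) : t1 <= t2 ->
  'i%C * cint t1 t2 (fun t => ((c + d * H s2 t) - (c + d * H s1 t)) * kap t) =
  d * (s2 - s1)%:C * (circ t2 - circ t1).
Proof.
move=> t12; rewrite -cintZ; last first.
  apply: ccontM => //; apply: ccontB; apply: ccontD; try exact: ccont_cst.
    apply: ccontZ; apply: ccontD; first exact: ccont_cst.
    by apply/ccontZ/ccontB; [exact: ccont_circ|exact: ccont_cst].
  apply: ccontZ; apply: ccontD; first exact: ccont_cst.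
  by apply/ccontZ/ccontB; [exact: ccont_circ|exact: ccont_cst].
transitivity (cint t1 t2 (fun t => (d * (s2 - s1)%:C * r%:C) * ('i%C * ecis t))).
  apply: eq_cint => t _; rewrite /H /kap rmorphB/=.
  have := circ_neq t; rewrite /circ => n0; by field.
rewrite cintZ; last exact/ccontZ/ccont_ecis.
by rewrite cint_iecis// /circ; ring.
Qed.

Let Lam_affine_s s1 s2 t1 t2 (d c : C) : 0 < s1 -> s1 <= s2 ->
  cint s1 s2 (fun s => ((c + d * H s t2) - (c + d * H s t1)) * (s%:C)^-1) =
  d * (s2 - s1)%:C * (circ t2 - circ t1).
Proof.
move=> s10 s12.
transitivity (cint s1 s2 (fun=> d * (circ t2 - circ t1))).
  apply: eq_cint => s /andP[s1s _]; rewrite /H.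
  have s0 : (s%:C : C) != 0.
    by rewrite -cabs_eq0 cabs_real gtr0_norm ?gt_eqF//; exact: lt_le_trans s1s.
  by field.
by rewrite cint_cst//; ring.
Qed.

Let ccont_affine (g : R -> C) a b (c d : C) : ccont a b g -> ccont a b (fun t => c + d * g t).
Proof. by move=> cg; apply: ccontD; [exact: ccont_cst|exact: ccontZ]. Qed.

Let Lam_local (S1 : R) s t : 0 < S1 -> S1 <= s <= 1 -> forall e : R, 0 < e ->
  exists2 d : R, 0 < d & forall s1 s2 t1 t2, S1 <= s1 -> s1 <= s <= s2 -> s2 <= 1 ->
    t1 <= t <= t2 -> s2 - s1 < d -> t2 - t1 < d ->
    cabs (Lam s1 s2 t1 t2) <= e * ((s2 - s1) + (t2 - t1)) ^+ 2.
Proof.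
move=> S0 /andP[Ss s_1] e e0; have s01 : 0 <= s <= 1 by rewrite s_1 andbT; lra.
have [D fD] := df (cabs_H t s01).
(* The errors of the two integrals add up to at most [4 * E * (K + S1^-1) * w] with
   [E = e / k * (2 * w)]; the 8 makes this exactly [e * w ^+ 2]. *)
set k := 8 * (K + S1^-1); have S1V : 0 < S1^-1 by rewrite invr_gt0.
have k0 : 0 < k by rewrite /k; have := K0; lra.
have [q q0 hq] := fD _ (divr_gt0 e0 k0).
(* Then [2 * w < q], and by [H_lip] the image of the rectangle lies where the expansion of [f]
   holds. *)
exists (q / 4); first by rewrite divr_gt0.
move=> s1 s2 t1 t2 Ss1 /andP[s1s ss2] s2_1 /andP[t1t tt2] ds dt.
have s12 : s1 <= s2 by exact: le_trans ss2.
have t12 : t1 <= t2 by exact: le_trans tt2.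
have s10 : 0 < s1 by exact: lt_le_trans Ss1.
have hs1 : 0 <= s1 <= 1 by lra.
have hs2 : 0 <= s2 <= 1 by lra.
set c := f (H s t) - D * H s t.
set w := (s2 - s1) + (t2 - t1); set E := e / k * (2 * w).
have w0 : 0 <= w by rewrite /w; lra.
have E0 : 0 <= E by rewrite /E; apply: mulr_ge0; [rewrite divr_ge0// ltW|lra].
have near u v : s1 <= u <= s2 -> t1 <= v <= t2 -> cabs (f (H u v) - (c + D * H u v)) <= E.
  move=> /andP[u1 u2] /andP[v1 v2].
  have hl : cabs (H u v - H s t) <= 2 * w.
    apply: le_trans (H_lip _ _ _ s01) _.
    have : `|u - s| <= s2 - s1 by rewrite ler_norml; lra.
    have : `|v - t| <= t2 - t1 by rewrite ler_norml; lra.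
    by rewrite /w; lra.
  have -> : f (H u v) - (c + D * H u v) = f (H u v) - f (H s t) - D * (H u v - H s t).
    by rewrite /c; ring.
  apply: le_trans (hq _ _) _; first by rewrite /w in hl; lra.
  by rewrite /E; apply: ler_wpM2l => //; rewrite divr_ge0// ltW.
have a1 := Lam_affine_t s1 s2 D c t12.
have a2 := Lam_affine_s t1 t2 D c s10 s12.
have b1 : cabs (It s1 s2 t1 t2 - cint t1 t2 (fun t => ((c + D * H s2 t) - (c + D * H s1 t)) * kap t))
    <= 2 * ((t2 - t1) * (2 * E * K)).
  apply: cint_close => //; first exact: ccont_It.
    by apply: ccontM => //; apply: ccontB; apply: ccont_affine; exact: ccont_Ht.
  move=> v hv; rewrite -mulrBl cabsM; apply: ler_pM; rewrite ?cabs_ge0//.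
  have -> : f (H s2 v) - f (H s1 v) - (c + D * H s2 v - (c + D * H s1 v)) =
    (f (H s2 v) - (c + D * H s2 v)) - (f (H s1 v) - (c + D * H s1 v)) by ring.
  apply: le_trans (cabsD _ _) _; rewrite cabsN.
  have := near s2 v; have := near s1 v; rewrite !lexx s12 hv => /(_ isT isT) h1 /(_ isT isT) h2.
  by lra.
have b2 : cabs (Is s1 s2 t1 t2 - cint s1 s2 (fun s => ((c + D * H s t2) - (c + D * H s t1)) * (s%:C)^-1))
    <= 2 * ((s2 - s1) * (2 * E * S1^-1)).
  apply: cint_close => //; first exact: ccont_Is.
    apply: ccontM; last exact: ccont_sinv.
    by apply: ccontB; apply: ccont_affine; apply: ccont_Hs => //; exact: ltW.
  move=> u hu; rewrite -mulrBl cabsM; apply: ler_pM; rewrite ?cabs_ge0//.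
    have -> : f (H u t2) - f (H u t1) - (c + D * H u t2 - (c + D * H u t1)) =
      (f (H u t2) - (c + D * H u t2)) - (f (H u t1) - (c + D * H u t1)) by ring.
    apply: le_trans (cabsD _ _) _; rewrite cabsN.
    have := near u t2; have := near u t1; rewrite !lexx t12 hu => /(_ isT isT) h1 /(_ isT isT) h2.
    by lra.
  move: hu => /andP[hu _]; have u0 : 0 < u by exact: lt_le_trans hu.
  rewrite cabsV cabs_real gtr0_norm// lef_pV2 ?posrE//; exact: le_trans hu.
rewrite /Lam.
set X := It _ _ _ _ in b1 *; set Y := Is _ _ _ _ in b2 *.
set X' := cint t1 t2 _ in a1 b1; set Y' := cint s1 s2 _ in a2 b2.
have -> : 'i%C * X - Y = 'i%C * (X - X') - (Y - Y').
  have XY : 'i%C * X' = Y' by rewrite a1 a2.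
  by rewrite mulrBr XY; ring.
apply: le_trans (cabsD _ _) _; rewrite cabsN cabsM cabs_i mul1r.
have step : 2 * ((t2 - t1) * (2 * E * K)) + 2 * ((s2 - s1) * (2 * E * S1^-1)) <=
    4 * E * (K + S1^-1) * w.
  have EK : 0 <= E * K by rewrite mulr_ge0// ltW.
  have ES : 0 <= E * S1^-1 by rewrite mulr_ge0// ltW.
  have := mulr_ge0 EK (_ : 0 <= s2 - s1); rewrite subr_ge0 => /(_ s12).
  have := mulr_ge0 ES (_ : 0 <= t2 - t1); rewrite subr_ge0 => /(_ t12).
  by rewrite /w; nra.
apply: (le_trans (lerD b1 b2)); apply: (le_trans step).
have -> : e * w ^+ 2 = 4 * E * (K + S1^-1) * w; last by [].
have kE : e = e / k * k by rewrite divfK// gt_eqF.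
by rewrite {1}kE /E /k; ring.
Qed.

Let T : R := pi *+ 2.
Let T0 : 0 <= T. Proof. by rewrite mulrn_wge0// pi_ge0. Qed.

(** Shrinking the circle to [H s] does not change the integral of [f] against [kap], and [f (H s t)]
    tends to [f z0] uniformly in t as s tends to 0. *)
Let cauchy_kernel : cint 0 T (fun t => (f (circ t) - f z0) * kap t) = 0.
Proof.
have H1 t : H 1 t = circ t by rewrite /H rmorph1; ring.
have z01 : cabs z0 < 1 by exact: lt_trans r1.
have It0 s : 0 < s -> s <= 1 -> It s 1 0 T = 0.
  move=> s0 s1; have Lam0 : Lam s 1 0 T = 0.
    apply: (@bisection_eq0 _ s 1 0 T Lam) => //.
    - by move=> s1' m s2 t1 t2 *; exact: (@Lam_split_s s).
    - by move=> s1' s2 t1 m t2 *; exact: (@Lam_split_t s).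
    move=> s' t hs' ht e e0; have [d d0 hd] := Lam_local t s0 hs' e0.
    by exists d => // s1' s2 t1 t2 *; apply: hd.
  (* The sides t = 0 and t = 2 pi have the same image, so their contributions cancel. *)
  have Is0 : Is s 1 0 T = 0.
    rewrite /Is -[RHS](mulr0 ((1 - s)%:C)) -cint_cst//; apply: eq_cint => u _.
    by rewrite /H /circ ecis2pi ecis0 subrr mul0r.
  move: Lam0; rewrite /Lam Is0 subr0 => /eqP; rewrite mulf_eq0 => /orP[/eqP i0|/eqP//].
  by have := cabs_i R; rewrite i0 cabs0 => /esym/eqP; rewrite oner_eq0.
apply/eqP; rewrite -cabs_eq0 eq_le cabs_ge0 andbT; apply: cabs_le_eps => e e0.
set B := 2 * (T * K) + 1; have B0 : 0 < B.
  by have := mulr_ge0 T0 (ltW K0); rewrite /B; lra.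
have [d /cdiff_cont /(_ _ (divr_gt0 e0 B0))[q q0 hq]] := df z01.
(* Since [H s t - z0] has modulus at most [2 * s], this keeps it below [q]. *)
set s := Num.min 1 (q / 4); have s0 : 0 < s by rewrite lt_min ltr01/= divr_gt0.
have s1 : s <= 1 by rewrite ge_min lexx.
have sq : s <= q / 4 by rewrite ge_min lexx orbT.
have hs : 0 <= s <= 1 by rewrite ltW.
have h1 : (0 : R) <= 1 <= (1 : R) by rewrite ler01 lexx.
rewrite -[cint _ _ _]subr0 -(It0 s)// add0r.
apply: le_trans (@cint_close _ _ _ _ _ (e / B * K) _ _ _ _) _ => //.
- apply: ccontM => //; apply: ccontB; last exact: ccont_cst.
  by under eq_fun do rewrite -H1; exact: ccont_fHt.
- exact: ccont_It.
- move=> t _; rewrite -mulrBl cabsM H1; apply: ler_pM; rewrite ?cabs_ge0//.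
  have -> : f (circ t) - f z0 - (f (circ t) - f (H s t)) = f (H s t) - f z0 by ring.
  apply: hq; rewrite /H addrAC subrr add0r cabsM cabs_real gtr0_norm//.
  by have := ler_wpM2l (ltW s0) (circ_dist2 t); lra.
rewrite subr0; have -> : 2 * (T * (e / B * K)) = e * ((2 * (T * K)) / B) by ring.
by rewrite ger_pMr// ler_pdivrMr// /B; lra.
Qed.

(** Here [kap t] is the sum of the geometric series of ratio [z0 / circ t]. Its finite form with the
    remainder [kap t * (z0 / circ t) ^+ N] is integrated, so no infinite sum is exchanged with the
    integral. *)
Let geometric_kernel (g : R -> C) (M : R) : ccont 0 T g ->
  (forall t, 0 <= t <= T -> cabs (g t) <= M) ->
  csum (fun n => cint 0 T (fun t => g t * (circ t)^-1 ^+ n) * z0 ^+ n)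
       (cint 0 T (fun t => g t * kap t)).
Proof.
move=> cg gM; set u := fun t => (circ t)^-1.
have c0 t : circ t != 0 by rewrite -cabs_eq0 cabs_circ gt_eqF.
have cu : ccont 0 T u.
  by apply: (@ccont_inv _ _ _ _ r) => // t _; rewrite cabs_circ.
set y := cabs z0 / r.
have y0 : 0 <= y by rewrite divr_ge0 ?cabs_ge0// ltW.
have y1 : y < 1 by rewrite ltr_pdivrMr// mul1r.
have M0 : 0 <= M by apply: le_trans (gM 0 _); rewrite ?cabs_ge0 ?lexx.
have cgk : ccont 0 T (fun t => g t * kap t) by exact: ccontM.
have cgkq N : ccont 0 T (fun t => g t * kap t * (z0 * u t) ^+ N).
  by apply: ccontM cgk _; apply: ccontX; exact: ccontZ.
have sumE N : \sum_(n < N) cint 0 T (fun t => g t * u t ^+ n) * z0 ^+ n -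
    cint 0 T (fun t => g t * kap t) = - cint 0 T (fun t => g t * kap t * (z0 * u t) ^+ N).
  suff -> : \sum_(n < N) cint 0 T (fun t => g t * u t ^+ n) * z0 ^+ n =
      cint 0 T (fun t => g t * kap t) - cint 0 T (fun t => g t * kap t * (z0 * u t) ^+ N).
    by rewrite addrAC subrr add0r.
  rewrite -cintB//.
  have cZ n : cint 0 T (fun t => g t * u t ^+ n) * z0 ^+ n =
      cint 0 T (fun t => z0 ^+ n * (g t * u t ^+ n)).
    by rewrite mulrC cintZ//; apply: ccontM => //; exact: ccontX.
  under eq_bigr do rewrite cZ.
  rewrite -(@cint_sum _ _ _ N (fun n t => z0 ^+ n * (g t * u t ^+ n))); last first.
    by move=> i; apply: ccontZ; apply: ccontM => //; exact: ccontX.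
  apply: eq_cint => t _.
  under eq_bigr => n _ do rewrite mulrCA -exprMn.
  rewrite -mulr_sumr; set q := z0 * u t.
  have -> : g t * kap t - g t * kap t * q ^+ N = g t * (- kap t * (q ^+ N - 1)) by ring.
  congr (_ * _); rewrite subrX1 mulrA.
  have -> : - kap t * (q - 1) = 1; last by rewrite mul1r.
  by rewrite /kap /q /u; field; rewrite c0 circ_neq.
move=> e e0.
set B := 2 * (T * (M * K)) + 1.
have B0 : 0 < B by have := mulr_ge0 T0 (mulr_ge0 M0 (ltW K0)); rewrite /B; lra.
have y1' : `|y| < 1 by rewrite ger0_norm.
have /(@cvgrPdist_lt _ R) /(_ _ (divr_gt0 e0 B0))[N _ hN] := cvg_expr y1'.
exists N => n Nn; rewrite sumE cabsN.
have := hN n Nn.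
rewrite /= sub0r normrN normrX ger0_norm// ltr_pdivlMr// => yn.
apply: le_lt_trans yn.
have -> : y ^+ n * B = 2 * (T * (M * K * y ^+ n)) + y ^+ n by rewrite /B; ring.
apply: ler_wpDr; first exact: exprn_ge0.
rewrite -[X in _ * (X * _)]subr0; apply: cint_le => //.
move=> t ht; have hq : cabs (z0 * u t) = y by rewrite cabsM /u cabsV cabs_circ.
rewrite [cabs (_ * _ ^+ n)]cabsM cabsX hq [cabs (g t * _)]cabsM.
by apply: ler_wpM2r; [exact: exprn_ge0|apply: ler_pM; rewrite ?cabs_ge0// gM].
Qed.

Definition circle_coef (f : C -> C) (r : R) n : C := ((pi *+ 2)^-1)%:C *
  cint 0 (pi *+ 2) (fun t => f (r%:C * ecis t) * (r%:C * ecis t)^-1 ^+ n).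

Lemma cauchy_taylor (M : R) : (forall z, cabs z = r -> cabs (f z) <= M) ->
  csum (fun n => circle_coef f r n * z0 ^+ n) (f z0).
Proof.
move=> fM; have T_gt0 : 0 < T by rewrite /T mulrn_wgt0// pi_gt0.
have cf : ccont 0 T (fun t => f (circ t)).
  by apply: ccont_comp; [exact: ccont_circ|move=> t _; apply: df; rewrite cabs_circ].
(* The case [g = 1] of the expansion: every term with n > 0 integrates to 0 over a period. *)
have kapE : cint 0 T kap = T%:C.
  have le11 t : 0 <= t <= T -> cabs (1 : C) <= 1 by rewrite cabs1.
  have h1 := @geometric_kernel (fun=> 1) 1 (@ccont_cst _ _ _ _) le11.
  have -> : cint 0 T kap = cint 0 T (fun t => 1 * kap t).
    by apply: eq_cint => t _; rewrite mul1r.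
  have h2 := @csum_finite _ (fun n => cint 0 T (fun t => 1 * (circ t)^-1 ^+ n) * z0 ^+ n) 1.
  rewrite (csum_uniq h1 (h2 _)).
    rewrite big_ord1 expr0 mulr1 -[T in RHS]subr0 -[RHS]mulr1 -cint_cst//.
    by apply: eq_cint => t _; rewrite expr0 mulr1.
  move=> [//|n] _.
  have -> : cint 0 T (fun t => 1 * (circ t)^-1 ^+ n.+1) =
    cint 0 T (fun t => (r%:C)^-1 ^+ n.+1 * ecis (- n.+1%:R * t)).
    apply: eq_cint => t _; rewrite mul1r /circ invfM exprMn mulNr ecisN -ecisX.
    by rewrite !exprVn.
  by rewrite cintZ ?cint_ecis_pow// ?mulr0 ?mul0r//; exact: ccont_ecis_lin.
have h := @geometric_kernel (fun t => f (circ t)) M cf (fun t _ => fM _ (cabs_circ t)).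
have fE : cint 0 T (fun t => f (circ t) * kap t) = T%:C * f z0.
  have := cauchy_kernel.
  have -> : cint 0 T (fun t => (f (circ t) - f z0) * kap t) =
     cint 0 T (fun t => f (circ t) * kap t - f z0 * kap t).
    by apply: eq_cint => t _; rewrite mulrBl.
  rewrite cintB; [|exact: ccontM|exact: ccontZ].
  by rewrite cintZ// kapE => /eqP; rewrite subr_eq0 mulrC => /eqP.
move: (csumZ (T^-1)%:C h); rewrite fE mulrA -rmorphM/= mulVf ?gt_eqF// rmorph1 mul1r.
by under eq_fun do rewrite mulrA.
Qed.

Lemma circle_coef_le (M : R) n : (forall z, cabs z = r -> cabs (f z) <= M) ->
  cabs (circle_coef f r n) * r ^+ n <= 2 * M.
Proof.
move=> fM; have T_gt0 : 0 < T by rewrite /T mulrn_wgt0// pi_gt0.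
have rn0 : 0 < r ^+ n by rewrite exprn_gt0.
have cf : ccont 0 T (fun t => f (circ t)).
  by apply: ccont_comp; [exact: ccont_circ|move=> t _; apply: df; rewrite cabs_circ].
have cu : ccont 0 T (fun t => (circ t)^-1).
  by apply: (@ccont_inv _ _ _ _ r) => // t _; rewrite cabs_circ.
have cX : ccont 0 T (fun t => (circ t)^-1 ^+ n) by exact: ccontX.
have : cabs (cint 0 T (fun t => f (circ t) * (circ t)^-1 ^+ n)) <= 2 * ((T - 0) * (M / r ^+ n)).
  apply: cint_le => //; first exact: ccontM.
  move=> t _; rewrite cabsM cabsX cabsV cabs_circ -exprVn.
  by apply: ler_wpM2r (fM _ (cabs_circ t)); rewrite exprn_ge0// invr_ge0 ltW.
rewrite subr0 => h; rewrite /circle_coef cabsM cabs_real gtr0_norm ?invr_gt0//.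
rewrite -/T -/circ -mulrA mulrC ler_pdivrMr//.
rewrite -(ler_pM2r rn0) in h; apply: le_trans h _.
by rewrite -!mulrA mulVf ?gt_eqF// mulr1 [T * M]mulrC mulrA.
Qed.

End cauchy.

(** * Growth spaces *)

Section growth.
Variable R : realType.
Local Notation C := R[i].
Implicit Types (f : C -> C^o) (z : C).

Lemma eq_psf (a b : nat -> C) : (forall z, cabs z < 1 -> psf a z = psf b z) -> psf a = psf b.
Proof.
move=> ab; apply/funext => z; have [/ab//|z1] := boolP (cabs z < 1).
by rewrite (psf_out a (negP z1)) (psf_out b (negP z1)).
Qed.

Lemma bernoulli_sub (x : R) n : 0 <= x <= 1 -> 1 - n%:R * x <= (1 - x) ^+ n.
Proof.
move=> /andP[x0 x1]; elim: n => [|n ih]; first by rewrite expr0 mul0r subr0.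
have h0 : 0 <= 1 - x by lra.
rewrite exprS -natr1; apply: le_trans (ler_wpM2l h0 ih).
have : 0 <= n%:R * x ^+ 2 by rewrite mulr_ge0// sqr_ge0.
by rewrite expr2; lra.
Qed.

Definition growth_le (mu M : R) f :=
  forall z, cabs z < 1 -> (1 - cabs z) `^ mu * cabs (f z) <= M.

Lemma growth_spaceP mu f :
  growth_space mu f <-> holomorphic f /\ exists M, growth_le mu M f.
Proof. by split=> -[hf /growth_normP]. Qed.

Lemma growth_le_ge0 mu M f : growth_le mu M f -> 0 <= M.
Proof.
move=> /(_ 0); rewrite cabs0 => /(_ ltr01); apply: le_trans.
by rewrite mulr_ge0 ?powR_ge0 ?cabs_ge0.
Qed.

(** Since [1 - r <= 1], the real exponent may be rounded up to a natural number. *)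
Lemma growth_le_circle mu M f : growth_le mu M f -> exists p : nat,
  forall (r : R) z, 0 <= r -> r < 1 -> cabs z = r -> cabs (f z) <= M / (1 - r) ^+ p.
Proof.
move=> fM; exists (Num.truncn `|mu|).+1 => r z r0 r1 zr.
have h : 0 < 1 - r <= 1 by rewrite subr_gt0 r1/= lerBlDr lerDl.
have p0 : 0 < (1 - r) ^+ (Num.truncn `|mu|).+1 by rewrite exprn_gt0//; lra.
rewrite ler_pdivlMr// mulrC.
have := fM z; rewrite zr => /(_ r1); apply: le_trans; apply: ler_wpM2r; first exact: cabs_ge0.
rewrite -powR_mulrn; last by lra.
apply: ger_powR => //; apply: le_trans (ler_norm _) _; exact/ltW/truncnS_gt.
Qed.

(** The coefficients obtained on different circles are first shown to agree; the n-th one can then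
    be estimated on a radius that depends on n. *)
Lemma growth_taylor mu f : growth_space mu f -> exists2 a, polybnd a & f = psf a.
Proof.
move=> /growth_spaceP[[df f0] [M fM]]; have M0 := growth_le_ge0 fM.
have cdf z : cabs z < 1 -> exists d, cdiff f z d by move=> /df; exact: derivable_cdiff.
have [p fp] := growth_le_circle fM.
have [c [c_le c_sum]] : exists c : R -> nat -> C,
    (forall (r : R) n, 0 < r -> r < 1 -> cabs (c r n) * r ^+ n <= 2 * (M / (1 - r) ^+ p)) /\
    (forall (r : R) z, r < 1 -> cabs z < r -> csum (fun n => c r n * z ^+ n) (f z)).
  exists (circle_coef f); split=> [r n r0 r1|r z r1 zr].
    apply: (@circle_coef_le _ f r 0 cdf r1); first by rewrite cabs0.
    by move=> z zr; apply: fp => //; exact: ltW.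
  apply: (@cauchy_taylor _ f r z cdf r1 zr (M / (1 - r) ^+ p)).
  by move=> w; apply: fp => //; apply: le_trans (ltW zr); exact: cabs_ge0.
(* Scaled by the smaller radius [r], both sequences are bounded and represent [f (r%:C * z)] on the
   whole disc, so [psf_inj] identifies them. *)
have c_lt (r s : R) n : 0 < r -> r < s -> s < 1 -> c r n = c s n.
  move=> r0 rs s1; have s0 : 0 < s by exact: lt_trans rs.
  have r1 : r < 1 by exact: lt_trans s1.
  have pr : polybnd (fun n => c r n * r%:C ^+ n).
    exists 0%N, (2 * (M / (1 - r) ^+ p)) => m.
    by rewrite expr0 mulr1 cabsM cabsX cabs_real gtr0_norm//; exact: c_le.
  have ps : polybnd (fun n => c s n * r%:C ^+ n).
    exists 0%N, (2 * (M / (1 - s) ^+ p)) => m.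
    rewrite expr0 mulr1 cabsM cabsX cabs_real gtr0_norm//; apply: le_trans (c_le s m s0 s1).
    by apply: ler_wpM2l; [exact: cabs_ge0|rewrite lerXn2r ?nnegrE// ltW].
  have e u z : r <= u -> u < 1 -> cabs z < 1 ->
      csum (fun n => c u n * r%:C ^+ n * z ^+ n) (f (r%:C * z)).
    move=> ru u1 z1; under eq_fun do rewrite -mulrA -exprMn; apply: c_sum => //.
    by apply: lt_le_trans ru; rewrite cabsM cabs_real gtr0_norm// gtr_pMr.
  have psE : psf (fun m => c r m * r%:C ^+ m) = psf (fun m => c s m * r%:C ^+ m).
    apply: eq_psf => z z1.
    by rewrite (psf_eq z1 (e r z (lexx r) r1 z1)) (psf_eq z1 (e s z (ltW rs) s1 z1)).
  apply: (mulIf _ (psf_inj pr ps psE n)).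
  by rewrite expf_neq0// -cabs_eq0 cabs_real gtr0_norm ?gt_eqF.
have c_eq (r : R) n : 0 < r -> r < 1 -> c r n = c (2^-1) n.
  move=> r0 r1; have [h|h|->//] := ltgtP r 2^-1.
    by apply: c_lt => //; lra.
  by symmetry; apply: c_lt => //; lra.
(* Cauchy's estimate on the circle of radius [1 - 1/(n+2)]. *)
have pc : polybnd (c 2^-1).
  exists p.+1, (M * 2 ^+ p.+1) => n; have [q [qE q2]] : exists q : R, q = n.+2%:R /\ 2 <= q.
    by exists n.+2%:R; rewrite ler_nat.
  have q0 : 0 < q by lra.
  have qV : 0 < q^-1 by rewrite invr_gt0.
  have qV2 : q^-1 <= 1 / 2 by rewrite div1r lef_pV2 ?posrE.
  have g0 : 0 < 1 - q^-1 by lra.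
  have g1 : 1 - q^-1 < 1 by lra.
  have h : cabs (c 2^-1 n) * (1 - q^-1) ^+ n <= 2 * (M * q ^+ p).
    have e : 1 - (1 - q^-1) = q^-1 by lra.
    by have := c_le _ n g0 g1; rewrite (c_eq _ _ g0 g1) e exprVn invrK.
  (* With q = n + 2, Bernoulli's bound 1 - n/q equals 2/q. This costs one power of q, whence the
     exponent [p.+1]; the base 2 of the constant comes from n + 2 <= 2 (n + 1). *)
  have hb : 2 / q <= (1 - q^-1) ^+ n.
    have hx : 0 <= q^-1 <= 1 by apply/andP; split; lra.
    apply: le_trans (bernoulli_sub n hx).
    have -> : n%:R = q - 2 by rewrite qE -!natr1; lra.
    by rewrite mulrBl divff ?gt_eqF//; lra.
  have := le_trans (ler_wpM2l (cabs_ge0 (c 2^-1 n)) hb) h.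
  rewrite mulrCA ler_pM2l// ler_pdivrMr// => h2; apply: le_trans h2 _.
  rewrite -!mulrA; apply: ler_wpM2l => //; rewrite -exprSr -exprMn.
  by rewrite lerXn2r ?nnegrE ?mulr_ge0 ?(ltW q0)// qE -natrM ler_nat; lia.
exists (c 2^-1) => //; apply/funext => z.
have [z1|z1] := boolP (cabs z < 1); last first.
  by rewrite psf_out ?f0//; exact/negP.
symmetry; apply: psf_eq => //.
have z0 := cabs_ge0 z; set r := (cabs z + 1) / 2.
have rE n : c 2^-1 n = c r n by rewrite c_eq// /r; lra.
under eq_fun do rewrite rE; apply: c_sum; rewrite /r; lra.
Qed.

Definition ishift (a : nat -> C) n := if n is m.+1 then a m / n%:R else 0.

Lemma polybnd_ishift a : polybnd a -> polybnd (ishift a).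
Proof.
move=> /polybnd_mono[p [B [B0 hB]]]; exists p, B => -[|n] /=.
  by rewrite cabs0 expr1n mulr1.
rewrite cabsM cabsV cabs_nat; apply: le_trans (_ : cabs (a n) <= _).
  by rewrite ler_piMr ?cabs_ge0// invf_le1 ?ltr0n// ler1n.
apply: le_trans (hB p (leqnn p) n) _; apply: ler_wpM2l => //.
by rewrite lerXn2r ?nnegrE// ler_nat.
Qed.

Lemma dshift_ishift a : dshift (ishift a) = a.
Proof.
apply/funext => n; by rewrite /dshift /= mulrCA divff ?mulr1.
Qed.

Lemma integrationE f z : cabs z < 1 ->
  integration f z = z * cint 0 1 (fun t => f (t%:C * z)).
Proof. by rewrite /integration => ->. Qed.

Lemma ray_disc (t : R) z : cabs z < 1 -> 0 <= t <= 1 -> cabs (t%:C * z) < 1.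
Proof.
move=> z1 /andP[t0 t1]; apply: le_lt_trans z1.
by rewrite cabsM cabs_real ger0_norm// ler_piMl// cabs_ge0.
Qed.

Lemma ray_ccont a z : polybnd a -> cabs z < 1 -> ccont 0 1 (fun t => psf a (t%:C * z)).
Proof.
move=> pa z1; apply: ccont_comp => [|t t01].
  apply: (@ccont_lip _ _ _ _ 1) => t t' _ _; rewrite -mulrBl -rmorphB cabsM cabs_real.
  by rewrite mul1r ler_piMr// ltW.
by exists (psf (dshift a) (t%:C * z)); apply: psf_cdiff => //; exact: ray_disc.
Qed.

(** On the ray t z, the function [psf (ishift a)] has t-derivative [z * psf a (t%:C * z)], and it
    vanishes at t = 0. *)
Lemma integration_psf a : polybnd a -> integration (psf a) = psf (ishift a).
Proof.
move=> pa; apply/funext => z; have pF := polybnd_ishift pa.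
have [z1|z1] := boolP (cabs z < 1); last first.
  by rewrite psf_out; [rewrite /integration (negbTE z1)|exact/negP].
have cc := ray_ccont pa z1.
rewrite integrationE// -cintZ//.
rewrite (@cint_FTC _ 0 1 (fun t => psf (ishift a) (t%:C * z)))//.
- by rewrite rmorph1 rmorph0 mul1r mul0r psf0 subr0.
- exact: ccontZ.
move=> t t01 e e0; have := psf_cdiff pF (ray_disc z1 t01).
rewrite dshift_ishift => /(_ _ e0)[r r0 hr]; exists r => // t' tt'.
have d_le : cabs (t'%:C * z - t%:C * z) <= `|t' - t|.
  by rewrite -mulrBl -rmorphB cabsM cabs_real ler_piMr// ltW.
have := hr (t'%:C * z) (le_lt_trans d_le tt').
have -> : psf a (t%:C * z) * (t'%:C * z - t%:C * z) = (t' - t)%:C * (z * psf a (t%:C * z)).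
  by rewrite rmorphB/=; ring.
by move=> /le_trans; apply; apply: ler_wpM2l => //; exact: ltW.
Qed.

(** The weight decreases along the ray, so the bound at [z] serves on the whole segment; the 2 is
    that of [cint_le]. *)
Lemma integration_growth_le mu M a : 0 <= mu -> polybnd a -> growth_le mu M (psf a) ->
  growth_le mu (2 * M) (integration (psf a)).
Proof.
move=> mu0 pa aM z z1; have M0 := growth_le_ge0 aM.
have w0 : 0 < (1 - cabs z) `^ mu by rewrite powR_gt0// subr_gt0.
rewrite integrationE// mulrC -ler_pdivlMr// cabsM.
apply: (@le_trans _ _ (1 * cabs (cint 0 1 (fun t => psf a (t%:C * z))))).
  by apply: ler_wpM2r; [exact: cabs_ge0|exact: ltW].
rewrite mul1r; have -> : 2 * M / (1 - cabs z) `^ mu = 2 * ((1 - 0) * (M / (1 - cabs z) `^ mu)).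
  by rewrite subr0 mul1r mulrA.
apply: cint_le => //; first exact: ray_ccont.
move=> t t01; have tz1 := ray_disc z1 t01; rewrite ler_pdivlMr// mulrC.
apply: le_trans (aM _ tz1); apply: ler_wpM2r; first exact: cabs_ge0.
have tz : cabs (t%:C * z) <= cabs z.
  case/andP: t01 => t0 t1.
  by rewrite cabsM cabs_real ger0_norm// ler_piMl// cabs_ge0.
by apply: ge0_ler_powR => //; rewrite ?nnegrE; lra.
Qed.

Lemma bounded_growth_le mu M f : 0 <= mu -> (forall z, cabs z < 1 -> cabs (f z) <= M) ->
  growth_le mu M f.
Proof.
move=> mu0 fM z z1; apply: le_trans (fM z z1).
rewrite ler_piMl ?cabs_ge0//; have : (1 - cabs z) `^ mu <= (1 - cabs z) `^ 0; last by rewrite powRr0.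
apply: ger_powR => //; by rewrite subr_gt0 z1/= lerBlDr lerDl cabs_ge0.
Qed.

End growth.

(** * Topology of the Korenblum type spaces *)

Section initial_tvs.
Variables (K : numFieldType) (E : lmodType K) (T : tvsType K) (f : {linear E -> T}).

Local Notation W := (initial_topology f).

HB.instance Definition _ := GRing.Lmodule.copy W E.

Let fW : W -> T := f.

Let initial_add_continuous : continuous (fun x : W * W => x.1 + x.2).
Proof.
apply: (@continuous_comp_initial E (W * W)%type T f).
have -> : f \o (fun x : W * W => (x.1 + x.2 : W)) =
  (fun y : T * T => y.1 + y.2) \o (fun x : W * W => (fW x.1, fW x.2)).
  by apply/funext => x /=; rewrite linearD.
move=> x; apply: continuous_comp; last exact: add_continuous.
by apply: cvg_pair; apply: continuous_comp;
  [exact: cvg_fst|exact: initial_continuous|exact: cvg_snd|exact: initial_continuous].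
Qed.

Let initial_scale_continuous : continuous (fun z : K^o * W => z.1 *: z.2).
Proof.
apply: (@continuous_comp_initial E (K^o * W)%type T f).
have -> : f \o (fun x : K^o * W => (x.1 *: x.2 : W)) =
  (fun y : K^o * T => y.1 *: y.2) \o (fun x : K^o * W => (x.1, fW x.2)).
  by apply/funext => x /=; rewrite linearZ.
move=> x; apply: continuous_comp; last exact: scale_continuous.
have h1 : (fun x : K^o * W => x.1) @ x --> x.1 by exact: cvg_fst.
have h2 : (fun x : K^o * W => fW x.2) @ x --> fW x.2.
  by apply: continuous_comp; [exact: cvg_snd|exact: initial_continuous].
exact: (cvg_pair h1 h2).
Qed.

Let initial_locally_convex :
  exists2 B : set_system W, (forall b, b \in B -> convex_set b) & basis B.
Proof.
have [B Bc [Bo Bb]] := @locally_convex K T.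
exists [set fW @^-1` b | b in B].
  move=> c /set_mem[b Bb' <-] x y l /set_mem /= bx /set_mem /= by_; apply/mem_set.
  have /set_mem := Bc b (mem_set Bb') (fW x) (fW y) l (mem_set bx) (mem_set by_).
  have e : f (l%:num *: (x : E) + (1 - l%:num) *: (y : E)) =
      l%:num *: f (x : E) + (1 - l%:num) *: f (y : E) by rewrite linearD !linearZ.
  by move=> bl; change (b (f (l%:num *: (x : E) + (1 - l%:num) *: (y : E)))); rewrite e.
split=> [_ [b Bb' <-]|x A].
  by apply: open_comp; [move=> ? _; exact: initial_continuous|exact: Bo].
rewrite nbhsE => -[_ [[V oV <-] Vx] VA].
have [b [Bb' bx] bV] : filter_from [set U | B U /\ U (f x)] id V.
  by apply: Bb; apply: open_nbhs_nbhs.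
exists (fW @^-1` b); first by split => //; exists b.
by move=> y /bV; exact: VA.
Qed.

HB.instance Definition _ :=
  PreTopologicalNmodule_isTopologicalNmodule.Build W initial_add_continuous.
HB.instance Definition _ :=
  TopologicalNmodule_isTopologicalLmodule.Build K W initial_scale_continuous.
HB.instance Definition _ := Uniform_isTvs.Build K W initial_locally_convex.

Definition initial_tvs : tvsType K := W.

End initial_tvs.

Section preimage.
Variable R : realType.
Local Notation C := R[i].

(** As [phi \o J] need not be bijective, the witness is [E] itself with the initial topology of
    [phi \o J], and the bijection is the identity. *)
Lemma locally_convex_preimage (E : lmodType C) (J : {linear E -> E}) (tau : set_system E) :
  locally_convex_topology tau -> locally_convex_topology [set J @^-1` U | U in tau].
Proof.
move=> [T [phi [_ ->]]].
pose f : {linear E -> T} := GRing.Linear.clone _ _ _ _ (phi \o J) _.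
exists (initial_tvs f).
have idl : linear (idfun : E -> initial_tvs f) by [].
pose g : {linear E -> initial_tvs f} := HB.pack (idfun : E -> initial_tvs f)
  (GRing.isLinear.Build _ _ _ _ _ idl).
exists g; split; first by exists idfun.
apply/seteqP; split=> [_ [_ [U oU <-] <-]|_ [_ [U oU <-] <-]].
  by exists (f @^-1` U) => //; exists U.
by exists (phi @^-1` U) => //; exists U.
Qed.

End preimage.

(** * Continuity and sequential limits tested on the subbase *)

Section korenblum_topology.
Variable R : realType.
Local Notation C := R[i].
Variable s : korenblum_index R.
Local Notation E := (korenblum s).

Lemma subbase_open (O : set E) : korenblum_subbase O -> open O.
Proof.
move=> sO; exists [set O]; last by rewrite bigcup_set1.
move=> _ ->; exists [fset O]%fset; first by move=> i /fset1P ->; exact/mem_set.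
by rewrite set_fset1 bigcap_set1.
Qed.

Lemma open_subbase (U : set E) x : open U -> U x ->
  exists D : {fset set E}, [/\ forall O, O \in D -> korenblum_subbase O,
    forall O, O \in D -> O x & forall y, (forall O, O \in D -> O y) -> U y].
Proof.
move=> [D' sD' <-] [B D'B Bx]; have [D sD DB] := sD' _ D'B.
exists D; split.
- by move=> O /sD /set_mem.
- by move=> O OD; move: Bx; rewrite -DB; apply.
move=> y yD; exists B => //.
have By : (\bigcap_(i in [set` D]) isSubBaseTopological.b i) y by move=> O OD; exact: yD.
by rewrite DB in By.
Qed.

Lemma korenblum_continuous (J : E -> E) :
  (forall O, korenblum_subbase O -> open (J @^-1` O)) -> continuous J.
Proof.
move=> Jo; apply/continuousP => U oU; rewrite openE => x /= Ux.
have [D [sD Dx DU]] := open_subbase oU Ux; rewrite /interior.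
have : nbhs x (\bigcap_(O in [set` D]) (J @^-1` O)).
  apply: filter_bigI => O OD; apply: open_nbhs_nbhs; split; last exact: Dx.
  exact/Jo/sD.
by apply: filterS => y yD; apply: DU => O OD; exact: yD.
Qed.

(** Closed sets contain limits of sequences in any topology, so metrizability, which is not at hand
    for [KMinus], does not enter. *)
Lemma seq_closed (M : set E) (x : nat -> E) y : closed M -> (forall n, M (x n)) ->
  (forall O, korenblum_subbase O -> O y -> exists N, forall n, (N <= n)%N -> O (x n)) -> M y.
Proof.
move=> cM Mx xy; apply: (closed_cvg M cM (u_ := x) (F := \oo)); first exact: nearW.
move=> A; rewrite nbhsE => -[B [oB By] BA].
have [D [sD Dy DU]] := open_subbase oB By.
have : nbhs \oo (\bigcap_(O in [set` D]) (x @^-1` O)).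
  apply: filter_bigI => O OD; have [N hN] := xy _ (sD _ OD) (Dy _ OD).
  by exists N => // n /= /hN.
by apply: filterS => n nD; apply/BA/DU => O OD; exact: nD.
Qed.

End korenblum_topology.

(** * Growth norms expressed by real bounds *)

Section growth_norms.
Variable R : realType.
Local Notation C := R[i].
Implicit Types f g : C -> C^o.

Lemma growth_norm_lt mu f (e : R) : (growth_norm mu f < e%:E)%E ->
  exists2 N : R, N < e & growth_le mu N f.
Proof.
move=> fe; have le_z z : cabs z < 1 ->
    (((1 - cabs z) `^ mu * cabs (f z))%:E <= growth_norm mu f)%E.
  by move=> zD; apply: ereal_sup_ubound; exists z.
case: (growth_norm mu f) fe le_z => [r||]; first by rewrite lte_fin => re h; exists r.
  by rewrite ltNge leey.
by move=> _ h; exists (e - 1); [lra|move=> z /h; rewrite leeNy_eq].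
Qed.

Lemma growth_le_norm mu f (N e : R) : growth_le mu N f -> N < e ->
  (growth_norm mu f < e%:E)%E.
Proof.
move=> fN Ne; apply: (@le_lt_trans _ _ N%:E); last by rewrite lte_fin.
by apply: ge_ereal_sup => _ [z zD <-]; rewrite lee_fin; exact: fN.
Qed.

Lemma growth_leD mu f g (M N : R) : growth_le mu M f -> growth_le mu N g ->
  growth_le mu (M + N) (f + g).
Proof.
move=> fM gN z z1; have := fM z z1; have := gN z z1.
have w0 := powR_ge0 (1 - cabs z) mu; have := ler_wpM2l w0 (cabsD (f z) (g z)).
rewrite mulrDr => h1 h2 h3; apply: le_trans h1 _; exact: lerD.
Qed.

Lemma growth_le_refl mu f : growth_le mu 0 (f - f).
Proof.
move=> z _; rewrite subrr.
have -> : cabs ((0 : C -> C^o) z) = 0 by exact: cabs0.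
by rewrite mulr0.
Qed.

Lemma growth_le_trans mu f (M N : R) : M <= N -> growth_le mu M f -> growth_le mu N f.
Proof. by move=> MN fM z z1; apply: le_trans (fM z z1) MN. Qed.

Lemma integration_growth_space mu f : 0 <= mu -> growth_space mu f ->
  growth_space mu (integration f).
Proof.
move=> mu0 fmu; have [a pa fE] := growth_taylor fmu.
move: fmu => /growth_spaceP[_ [M fM]]; apply/growth_spaceP; split.
  by rewrite fE integration_psf//; apply: psf_holomorphic; exact: polybnd_ishift.
by exists (2 * M); rewrite fE; apply: integration_growth_le => //; rewrite -fE.
Qed.

Lemma bounded_growth_space mu (M : R) f : 0 <= mu -> holomorphic f ->
  (forall z, cabs z < 1 -> cabs (f z) <= M) -> growth_space mu f.
Proof.
by move=> mu0 hf fM; apply/growth_spaceP; split=> //; exists M; exact: bounded_growth_le.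
Qed.

End growth_norms.

(** * The operator J and Taylor coefficients on the Korenblum type spaces *)

Section korenblum_space.
Variable R : realType.
Local Notation C := R[i].
Implicit Types s : korenblum_index R.

Definition admissible (s : korenblum_index R) (mu : R) : Prop :=
  match s with
  | KPlus gamma _ => gamma < mu
  | KMinus gamma _ => 0 < mu /\ (mu%:E < gamma)%E
  end.

Lemma admissible_gt0 s mu : admissible s mu -> 0 < mu.
Proof. by case: s => gamma g0 /=; [exact: le_lt_trans|case]. Qed.

Lemma admissible_ex s : exists mu, admissible s mu.
Proof.
case: s => gamma g0; first by exists (gamma + 1); rewrite /= ltrDl.
case: gamma g0 => [r||] g0 //=; last by exists 1; rewrite ltr01 ltry.
rewrite lte_fin in g0; exists (r / 2); rewrite lte_fin; split; lra.
Qed.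

Lemma korenblum_growth s (f : korenblum s) :
  exists2 mu, admissible s mu & growth_space mu (val f).
Proof.
have [mu0 amu0] := admissible_ex s; have := valP f.
case: s f mu0 amu0 => gamma g0 f mu0 /= amu0 /set_mem /=.
  by move=> h; exists mu0 => //; exact: h.
by move=> [mu [h1 h2] h3]; exists mu.
Qed.

Lemma integration_mem s (f : korenblum s) : integration (val f) \in korenblum_set s.
Proof.
have := valP f; case: s f => gamma g0 f /set_mem /= h; apply/mem_set => /=.
  move=> mu gmu; apply: integration_growth_space; last exact: h.
  exact: (le_trans g0 (ltW gmu)).
case: h => mu [mu0 mug] fmu; exists mu => //.
by apply: integration_growth_space => //; exact: ltW.
Qed.

Definition Jfun s (f : korenblum s) : korenblum s := exist (fun g => g \in korenblum_set s) _ (integration_mem f).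

Lemma val_Jfun s (f : korenblum s) : val (Jfun f) = integration (val f).
Proof. by []. Qed.

Lemma korenblum_taylor s (f : korenblum s) : exists2 a, polybnd a & val f = psf a.
Proof. by have [mu _] := korenblum_growth f; exact: growth_taylor. Qed.

(** Absolutely summable coefficients give a bounded function, which lies in every one of the spaces;
    this supplies monomials and dilations. *)
Lemma korenblum_bounded s (a : nat -> C) (B : R) : (forall n, \sum_(i < n) cabs (a i) <= B) ->
  polybnd a /\ exists f : korenblum s, val f = psf a.
Proof.
move=> aB; have pa : polybnd a.
  exists 0%N, B => n; rewrite expr0 mulr1; apply: le_trans (aB n.+1).
  by rewrite big_ord_recr/= lerDr; apply: sumr_ge0 => i _; exact: cabs_ge0.
split=> //; have gs mu : 0 <= mu -> growth_space mu (psf a).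
  move=> mu0; apply: (@bounded_growth_space _ _ B) => //; first exact: psf_holomorphic.
  by move=> z _; exact: psf_bound.
suff h : psf a \in korenblum_set s by exists (exist (fun g => g \in korenblum_set s) _ h).
apply/mem_set; have [mu amu] := admissible_ex s.
have mu0 := ltW (admissible_gt0 amu).
case: s amu => gamma g0 /= amu; last by exists mu => //; exact: gs.
by move=> nu gnu; apply: gs; exact: (le_trans g0 (ltW gnu)).
Qed.

Definition taylor s (f : korenblum s) n : C := @derive1n C C^o n (val f : C^o -> C^o) 0.

Lemma taylor_psf s (f : korenblum s) a n : polybnd a -> val f = psf a ->
  taylor f n = n`!%:R * a n.
Proof. by move=> pa fE; rewrite /taylor fE psf_derive1n0. Qed.

Lemma valD s (f g : korenblum s) : val (f + g) = val f + val g.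
Proof. by []. Qed.

Lemma valB s (f g : korenblum s) : val (f - g) = val f - val g.
Proof. by []. Qed.

Lemma valZ s (k : C) (f : korenblum s) : val (k *: f) = k *: val f.
Proof. by []. Qed.

Lemma taylorP s (k : C) (f g : korenblum s) n :
  taylor (k *: f + g) n = k * taylor f n + taylor g n.
Proof.
have [a pa fE] := korenblum_taylor f; have [b pb gE] := korenblum_taylor g.
rewrite (taylor_psf n pa fE) (taylor_psf n pb gE).
rewrite (taylor_psf n (polybndD (polybndZ k pa) pb)); first by ring.
by rewrite valD valZ fE gE psfD ?psfZ//; exact: polybndZ.
Qed.

Lemma taylor0 s n : taylor (0 : korenblum s) n = 0.
Proof. by have := taylorP (-1) 0 (0 : korenblum s) n; rewrite scaleN1r oppr0 addr0 mulN1r addNr. Qed.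

Lemma taylorD s (f g : korenblum s) n : taylor (f + g) n = taylor f n + taylor g n.
Proof. by rewrite -[f]scale1r taylorP mul1r scale1r. Qed.

Lemma taylorZ s (k : C) (f : korenblum s) n : taylor (k *: f) n = k * taylor f n.
Proof. by rewrite -[k *: f]addr0 taylorP taylor0 addr0. Qed.

Lemma taylorB s (f g : korenblum s) n : taylor (f - g) n = taylor f n - taylor g n.
Proof. by rewrite -scaleN1r taylorD taylorZ mulN1r. Qed.

Lemma taylor_sum s N (F : nat -> korenblum s) n :
  taylor (\sum_(j < N) F j) n = \sum_(j < N) taylor (F j) n.
Proof.
elim: N => [|N ih]; first by rewrite !big_ord0 taylor0.
by rewrite !big_ord_recr/= taylorD ih.
Qed.

Lemma taylor_inj s (f g : korenblum s) : (forall n, taylor f n = taylor g n) -> f = g.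
Proof.
have [a pa fE] := korenblum_taylor f; have [b pb gE] := korenblum_taylor g => fg.
apply: val_inj; rewrite /= fE gE; congr psf; apply/funext => n.
have := fg n; rewrite (taylor_psf n pa fE) (taylor_psf n pb gE).
by apply: mulfI; rewrite pnatr_eq0 -lt0n fact_gt0.
Qed.

Lemma taylor_J0 s (f : korenblum s) : taylor (Jfun f) 0 = 0.
Proof.
have [a pa fE] := korenblum_taylor f.
by rewrite (taylor_psf 0 (polybnd_ishift pa)) ?mulr0// val_Jfun fE integration_psf.
Qed.

Lemma taylor_JS s (f : korenblum s) n : taylor (Jfun f) n.+1 = taylor f n.
Proof.
have [a pa fE] := korenblum_taylor f.
rewrite (taylor_psf n.+1 (polybnd_ishift pa)); last by rewrite val_Jfun fE integration_psf.
rewrite (taylor_psf n pa fE) /= factS natrM [n.+1%:R * _]mulrC -mulrA; congr (_ * _).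
by rewrite mulrCA divff ?mulr1// pnatr_eq0.
Qed.

Lemma taylor_iterJ s (f : korenblum s) k n :
  taylor (iter k (@Jfun s) f) n = if (n < k)%N then 0 else taylor f (n - k).
Proof.
elim: k n => [|k ih] [|n] //=; rewrite ?subn0 ?taylor_J0// taylor_JS ih ltnS.
by case: ifP.
Qed.

Lemma Jfun_linear s : linear (@Jfun s).
Proof.
move=> k f g; apply: taylor_inj => -[|n]; rewrite taylorP ?taylor_J0 ?taylor_JS.
  by rewrite mulr0 addr0.
exact: taylorP.
Qed.

HB.instance Definition _ s := GRing.isLinear.Build C (korenblum s) (korenblum s) *:%R
  (@Jfun s) (@Jfun_linear s).

(** Each of the p factors n+1, ..., n+p is at least n+1, so n! (n+1)^p <= (n+p)!. *)
Lemma taylor_bound s (f : korenblum s) : exists p (B : R), 0 <= B /\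
  forall n, cabs (taylor f n) <= B * (n + p)`!%:R.
Proof.
have [a pa fE] := korenblum_taylor f; have [p [B [B0 hB]]] := polybnd_mono pa.
exists p, B; split=> // n; rewrite (taylor_psf n pa fE) cabsM cabs_nat.
apply: le_trans (ler_wpM2l _ (hB p (leqnn p) n)) _ => //.
rewrite mulrCA; apply: ler_wpM2l => //; rewrite -natrX -natrM ler_nat.
elim: (p) => [|k ih]; first by rewrite expn0 muln1 addn0.
by rewrite expnSr mulnA addnS factS mulnC; apply: leq_mul => //; lia.
Qed.

Lemma Jfun_growth_le s mu (N : R) (f g : korenblum s) : 0 <= mu ->
  growth_le mu N (val f - val g) -> growth_le mu (2 * N) (val (Jfun f) - val (Jfun g)).
Proof.
move=> mu0; rewrite -!valB -(linearB (@Jfun s)) val_Jfun.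
by have [a pa ->] := korenblum_taylor (f - g); exact: integration_growth_le.
Qed.

(** For [KPlus], J at most doubles each norm. For [KMinus], J maps every [growth_space mu]
    continuously into itself, so the pullback of a topology from the defining family is again in
    that family. *)
Lemma Jfun_continuous s : continuous (@Jfun s).
Proof.
apply: korenblum_continuous => O; case: s O => gamma g0 O /=.
  move=> [k [f [e [k0 e0 ->]]]]; set mu := gamma + _.
  have mu0 : 0 <= mu by rewrite /mu addr_ge0// invr_ge0.
  rewrite openE => g /= /growth_norm_lt[N Ne gN]; rewrite /interior nbhsE.
  (* After doubling by J, the perturbation uses half of the slack [e - N]. *)
  pose d := (e - N) / 4; have d0 : 0 < d by rewrite /d; lra.
  exists [set h : korenblum (KPlus g0) | (growth_norm mu (val h - val g)%R < d%:E)%E].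
    split; first by apply: subbase_open; exists k, g, d.
    exact: growth_le_norm (growth_le_refl _ _) d0.
  move=> h /= /growth_norm_lt[N' N'd hN'].
  apply: (@growth_le_norm _ _ _ (2 * d + N)); last by rewrite /d; lra.
  have -> : integration (val h) - val f =
     (val (Jfun h) - val (Jfun g)) + (val (Jfun g) - val f) by rewrite addrA subrK.
  apply: growth_leD => //; apply: Jfun_growth_le => //.
  by apply: growth_le_trans hN'; exact: ltW.
move=> [tau [ltau itau] tauO]; apply: subbase_open => /=.
exists [set (@Jfun (KMinus g0)) @^-1` U | U in tau]; last by exists O.
split; first exact: (locally_convex_preimage (Jfun (s := KMinus g0)) ltau).
move=> mu mu0 mug _ f [U tauU <-] Uf fmu.
have [e e0 he] := itau mu mu0 mug U (Jfun f) tauU Uf (integration_growth_space (ltW mu0) fmu).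
exists (e / 4); first by rewrite divr_gt0.
move=> g gmu /growth_norm_lt[N Ne gN]; apply: he.
  exact: integration_growth_space (ltW mu0) gmu.
apply: (@growth_le_norm _ _ _ (2 * N)); last by lra.
exact: (Jfun_growth_le (ltW mu0) gN).
Qed.

(** Convergence is required only in exponents above one whose space contains [y], which is what
    [dilation_growth] provides. Each subbasic set turns out to be controlled by such an exponent. *)
Lemma closed_growth s (M : set (korenblum s)) (x : nat -> korenblum s) y :
  closed M -> (forall n, M (x n)) ->
  (forall mu0 mu, 0 < mu0 -> mu0 < mu -> growth_space mu0 (val y) ->
    forall e, 0 < e -> exists N, forall n, (N <= n)%N -> growth_le mu e (val (x n) - val y)) ->
  M y.
Proof.
move=> cM Mx xy; apply: (seq_closed cM Mx) => O.
have [nu anu ynu] := korenblum_growth y; have nu0 := admissible_gt0 anu.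
case: s M x y cM Mx xy O anu ynu => gamma g0 M x y cM Mx xy O /=.
  move=> gnu ynu [k [f [e [k0 e0 ->]]]] /= /growth_norm_lt[N Ne yN].
  set mu := gamma + _ in yN *.
  have gmu : gamma < mu by rewrite /mu ltrDl invr_gt0 ltr0n.
  (* In the [KPlus] case [y] lies in [growth_space] for every exponent above [gamma], so the
     midpoint is available. *)
  pose mu0 := (gamma + mu) / 2.
  have [h1 h2] : gamma < mu0 /\ mu0 < mu by rewrite /mu0; lra.
  have ymu0 : growth_space mu0 (val y) by have /set_mem := valP y; apply.
  have d0 : 0 < (e - N) / 2 by lra.
  have [n0 hn0] := xy mu0 mu (le_lt_trans g0 h1) h2 ymu0 _ d0.
  exists n0 => n /hn0 xn; apply: (@growth_le_norm _ _ _ ((e - N) / 2 + N)); last by lra.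
  have -> : val (x n) - val f = (val (x n) - val y) + (val y - val f) by rewrite addrA subrK.
  exact: growth_leD.
move=> [_ nug] ynu [tau [ltau itau] tauO] Oy.
have [mu [numu mug]] : exists mu : R, nu < mu /\ (mu%:E < gamma)%E.
  case: gamma {g0 M x y cM Mx xy O ynu tau ltau itau tauO Oy} nug => [r||] //=.
    by rewrite lte_fin => nur; exists ((nu + r) / 2); rewrite lte_fin; split; lra.
  by move=> _; exists (nu + 1); rewrite ltry; split => //; lra.
have mu0 : 0 < mu by exact: lt_trans numu.
have ymu : growth_space mu (val y) by exact: growth_space_mono (ltW numu) _ ynu.
have [e e0 he] := itau mu mu0 mug O y tauO Oy ymu.
have e2 : 0 < e / 2 by rewrite divr_gt0.
have [n0 hn0] := xy nu mu nu0 numu ynu _ e2.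
exists n0 => n /hn0 xn; apply: he; last by apply: (growth_le_norm xn); lra.
(* [inclusion_continuous] sees only elements of [growth_space mu]; [x n] is one because [y] and the
   small difference are bounded in that weight. *)
move: ymu => /growth_spaceP[_ [L yL]]; apply/growth_spaceP; split.
  by have [m _ /growth_spaceP[]] := korenblum_growth (x n).
exists (e / 2 + L); have -> : val (x n) = (val (x n) - val y) + val y by rewrite subrK.
exact: growth_leD.
Qed.

Lemma closed_uniform s (M : set (korenblum s)) (x : nat -> korenblum s) y :
  closed M -> (forall n, M (x n)) ->
  (forall e : R, 0 < e -> exists N, forall n, (N <= n)%N ->
    forall z, cabs z < 1 -> cabs (val (x n - y) z) <= e) ->
  M y.
Proof.
move=> cM Mx xy; apply: (closed_growth cM Mx) => mu0 mu m0 m01 _ e e0.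
have [N hN] := xy e e0; exists N => n /hN xn; apply: bounded_growth_le => //.
by apply: ltW; exact: lt_trans m01.
Qed.

End korenblum_space.

(** * Invariant subspaces *)

Section reciprocal_series.
Variable R : realType.
Local Notation C := R[i].

(** Course-of-values recursion: [pre n] lists the first n coefficients, and [step] solves the n-th
    convolution equation for the next one. *)
Lemma reciprocal_ex (b : nat -> C) : b 0%N != 0 ->
  exists c : nat -> C, forall n, \sum_(j < n.+1) c j * b (n - j)%N = (n == 0%N)%:R.
Proof.
move=> b0; pose step n (s : seq C) :=
  (b 0%N)^-1 * ((n == 0%N)%:R - \sum_(j < n) s`_j * b (n - j)%N).
pose fix pre n := if n is m.+1 then rcons (pre m) (step m (pre m)) else [::].
have sz n : size (pre n) = n by elim: n => //= n ih; rewrite size_rcons ih.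
have nthE n m : (n < m)%N -> (pre m)`_n = step n (pre n).
  elim: m => // m ih; rewrite ltnS leq_eqVlt /= nth_rcons sz => /predU1P[->|nm].
    by rewrite ltnn eqxx.
  by rewrite nm ih.
exists (fun n => step n (pre n)) => n; rewrite big_ord_recr/= subnn.
under eq_bigr => j _ do rewrite -(nthE j n (ltn_ord j)).
by rewrite [X in _ + X]mulrC /step mulrA divff// mul1r addrC subrK.
Qed.

(** Log-convexity of the factorial: both sides have the same sum of arguments, spread further apart
    on the right. *)
Lemma fact_supermul m k q : ((m + q)`! * (k + q)`! <= q`! * (m + (k + q))`!)%N.
Proof.
elim: m => [|m ih]; first by rewrite !add0n.
rewrite !addSn !factS -mulnA [leqRHS]mulnCA.
by apply: leq_mul => //; rewrite ltnS leq_add2l leq_addl.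
Qed.

(** Telescoping: q - p - 1 times the j-th term is the drop of (j+1+p)! q! / (j+q)! from j to j+1. *)
Lemma fact_ratio (p q n : nat) : (p.+1 < q)%N ->
  (q - p.+1)%:R * (\sum_(j < n) (j.+1 + p)`!%:R * q`!%:R / (j.+1 + q)`!%:R) <=
    p.+1`!%:R - (n.+1 + p)`!%:R * q`!%:R / (n + q)`!%:R :> R.
Proof.
move=> pq; elim: n => [|n ih].
  by rewrite big_ord0 mulr0 add0n add1n mulfK ?subrr// pnatr_eq0 -lt0n fact_gt0.
rewrite big_ord_recr/= mulrDr; apply: le_trans (lerD ih (lexx _)) _.
have f0 m : (m`!%:R : R) != 0 by rewrite pnatr_eq0 -lt0n fact_gt0.
rewrite [(n.+1 + q)%N]addSn [(n.+2 + p)%N]addSn !factS !natrM natrB//.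
have n0 : (n + q).+1%:R != 0 :> R by rewrite pnatr_eq0.
rewrite le_eqVlt; apply/orP; left; apply/eqP.
have -> : (n.+1 + p).+1%:R = n%:R + p%:R + 2 :> R by rewrite -natr1 natrD -natr1; ring.
have qE : (n + q).+1%:R = n%:R + q%:R + 1 :> R by rewrite -natr1 natrD.
have -> : p.+1%:R = p%:R + 1 :> R by rewrite -natr1.
move: n0; rewrite qE => n0; field; by rewrite n0 f0.
exact: ltnW.
Qed.

(** After reversing the sum, [fact_supermul] bounds each term, relative to (n+q)!, by a term of
    [fact_ratio]. The constant (p+1)!/(q-p-1) is as small as desired for large q. *)
Lemma fact_convolution (p q n : nat) : (p.+1 < q)%N ->
  (q - p.+1)%:R * (\sum_(j < n) (j + q)`!%:R * (n - j + p)`!%:R) <=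
    p.+1`!%:R * (n + q)`!%:R :> R.
Proof.
move=> pq; have f0 m : 0 < (m`!%:R : R) by rewrite ltr0n fact_gt0.
have k0 : 0 <= (q - p.+1)%:R :> R by [].
have := fact_ratio n pq; rewrite -(ler_pM2r (f0 (n + q)%N)) => h.
have h2 : (p.+1`!%:R - (n.+1 + p)`!%:R * q`!%:R / (n + q)`!%:R) * (n + q)`!%:R <=
    p.+1`!%:R * (n + q)`!%:R :> R.
  rewrite ler_pM2r// lerBlDr lerDl; apply: divr_ge0; last exact: ltW.
  by apply: mulr_ge0; exact: ltW.
apply: le_trans (le_trans h h2); rewrite -mulrA; apply: ler_wpM2l => //.
rewrite (reindex_inj rev_ord_inj)/= mulr_suml; apply: ler_sum => i _.
have iE : (n - (n - i.+1) = i.+1)%N by have := ltn_ord i; lia.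
rewrite iE mulrC -!mulrA; apply: ler_wpM2l; first exact: ltW.
rewrite [_^-1 * _]mulrC mulrA ler_pdivlMr// -!natrM ler_nat.
have -> : (n + q = (n - i.+1) + (i.+1 + q))%N by have := ltn_ord i; lia.
exact: fact_supermul.
Qed.

(** The conclusion bounds the convolution of absolute values because truncating 1/b leaves partial
    sums of the convolution, where no cancellation is available. *)
Lemma reciprocal_bound (b c : nat -> C) (p : nat) (B : R) : b 0%N != 0 -> 0 <= B ->
  (forall n, cabs (b n) <= B * (n + p)`!%:R) ->
  (forall n, \sum_(j < n.+1) c j * b (n - j)%N = (n == 0%N)%:R) ->
  exists q (D : R), 0 <= D /\
    forall n, \sum_(j < n.+1) cabs (c j) * cabs (b (n - j)%N) <= D * (n + q)`!%:R.
Proof.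
move=> b0 B0 hb hc; have b0' : 0 < cabs (b 0%N) by rewrite lt_def cabs_eq0 b0 cabs_ge0.
(* The recursion reproduces the bound on [c] with the factor t / k, where k = q - p - 1; hence k is
   taken above t. *)
set t := B * p.+1`!%:R / cabs (b 0%N).
pose k := (Num.truncn t).+1; pose q := (p.+1 + k)%N.
have tk : t < k%:R by exact: truncnS_gt.
have pq : (p.+1 < q)%N by rewrite /q /k; lia.
have qk : (q - p.+1 = k)%N by rewrite /q; lia.
have f0 m : 0 < (m`!%:R : R) by rewrite ltr0n fact_gt0.
(* Chosen so that the bound at n = 0 is the exact modulus of c_0 = 1/b_0. *)
set Cq := (cabs (b 0%N))^-1 / q`!%:R.
have Cq0 : 0 <= Cq by rewrite divr_ge0 ?invr_ge0// ltW.
have conv n : (forall j, (j < n)%N -> cabs (c j) <= Cq * (j + q)`!%:R) ->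
    \sum_(j < n) cabs (c j) * cabs (b (n - j)%N) <= Cq * B * (p.+1`!%:R * (n + q)`!%:R / k%:R).
  move=> cn; apply: (@le_trans _ _ (Cq * B * \sum_(j < n) (j + q)`!%:R * (n - j + p)`!%:R)).
    rewrite mulr_sumr; apply: ler_sum => j _; rewrite mulrACA.
    by apply: ler_pM; rewrite ?cabs_ge0// cn.
  apply: ler_wpM2l; first exact: mulr_ge0.
  by rewrite ler_pdivlMr ?ltr0n// mulrC -qk; exact: fact_convolution.
have c_le n : cabs (c n) <= Cq * (n + q)`!%:R.
  elim/ltn_ind: n => n ih.
  have := hc n; rewrite big_ord_recr/= subnn => e.
  have {e} cE : c n * b 0%N = (n == 0%N)%:R - \sum_(j < n) c j * b (n - j)%N.
    by rewrite -e addrAC subrr add0r.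
  have {cE} : cabs (c n) * cabs (b 0%N) <= Cq * (n + q)`!%:R * cabs (b 0%N).
    rewrite -cabsM cE; case: n ih {cE} => [|n] ih.
      rewrite big_ord0 subr0 cabs1 add0n /Cq divfK ?gt_eqF// mulVf// gt_eqF//.
    rewrite sub0r cabsN; apply: le_trans (cabs_sum _ _ _) _.
    under eq_bigr do rewrite cabsM.
    apply: le_trans (conv _ ih) _.
    have -> : Cq * B * (p.+1`!%:R * (n.+1 + q)`!%:R / k%:R) =
      Cq * (n.+1 + q)`!%:R * (B * p.+1`!%:R / k%:R) by ring.
    apply: ler_wpM2l; first by apply: mulr_ge0 => //; exact: ltW.
    by rewrite ler_pdivrMr ?ltr0n// [leRHS]mulrC -ler_pdivrMr// ltW.
  by rewrite ler_pM2r.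
exists q, (Cq * B * (p.+1`!%:R / k%:R) + Cq * B * p`!%:R); split.
  have CB : 0 <= Cq * B by exact: mulr_ge0.
  by apply: addr_ge0; apply: mulr_ge0 => //; exact: divr_ge0.
move=> n; rewrite big_ord_recr/= subnn mulrDl; apply: lerD.
  apply: le_trans (conv n (fun j _ => c_le j)) _.
  by rewrite le_eqVlt; apply/orP; left; apply/eqP; ring.
have := ler_pM (cabs_ge0 _) (cabs_ge0 _) (c_le n) (hb 0%N).
by rewrite add0n; move=> /le_trans; apply; rewrite le_eqVlt; apply/orP; left; apply/eqP; ring.
Qed.

End reciprocal_series.

(** * Convergence of dilations in a larger weight *)

Section dilations.
Variable R : realType.
Local Notation C := R[i].

Lemma archi_div_le (D e : R) : 0 < e -> exists N, forall n, (N <= n)%N -> D / n.+1%:R <= e.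
Proof.
move=> e0; exists (Num.truncn (D / e)) => n Nn.
rewrite ler_pdivrMr ?ltr0n// mulrC -ler_pdivrMr//; apply: ltW.
by apply: lt_le_trans (truncnS_gt _) _; rewrite ler_nat ltnS.
Qed.

Lemma polybnd_dilate (a : nat -> C) (r : R) : 0 <= r <= 1 -> polybnd a ->
  polybnd (fun n => a n * r%:C ^+ n).
Proof.
move=> /andP[r0 r1] [p [B hB]]; exists p, B => n; apply: le_trans (hB n).
by rewrite cabsM cabsX cabs_real ger0_norm// ler_piMr ?cabs_ge0// exprn_ile1.
Qed.

Lemma psf_dilate (a : nat -> C) (r : R) z : 0 <= r <= 1 -> polybnd a -> cabs z < 1 ->
  psf (fun n => a n * r%:C ^+ n) z = psf a (r%:C * z).
Proof.
move=> r01 pa z1; apply: psf_eq => //.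
under eq_fun do rewrite -mulrA -exprMn; apply: psfP => //; exact: ray_disc.
Qed.

(** Near the circle the excess weight of exponent [mu - mu0] is small while both functions are
    bounded in weight [mu0]. On the remaining smaller disc the power series are compared
    termwise. *)
Lemma dilation_growth (a : nat -> C) (mu0 mu L : R) : polybnd a -> 0 < mu0 -> mu0 < mu ->
  growth_le mu0 L (psf a) -> forall e, 0 < e -> exists2 d, 0 < d &
    forall r : R, 0 <= r <= 1 -> 1 - r < d ->
      growth_le mu e (psf (fun n => a n * r%:C ^+ n) - psf a).
Proof.
move=> pa mu00 m01 fL e e0; have L0 := growth_le_ge0 fL.
pose nu := mu - mu0; have nu0 : 0 < nu by rewrite subr_gt0.
(* In weight [mu0] the difference is at most [2 * L]; the 1 guards against L = 0. Then [dl] is the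
   width of an annulus where the excess weight is at most [y]. *)
pose y := e / (2 * L + 1); have L1 : 0 < 2 * L + 1 by lra.
have y0 : 0 < y by rewrite divr_gt0.
pose dl := Num.min (1 / 2) (y `^ nu^-1).
have dl0 : 0 < dl by rewrite lt_min powR_gt0// andbT; lra.
have dl1 : dl <= 1 / 2 by rewrite ge_min lexx.
have dly : dl `^ nu <= y.
  have -> : y = (y `^ nu^-1) `^ nu by rewrite -powRrM mulVf ?gt_eqF// powRr1// ltW.
  apply: ge0_ler_powR; rewrite ?nnegrE ?powR_ge0//; try exact: ltW.
  by rewrite ge_min lexx orbT.
have x0 : 0 <= 1 - dl by lra.
have x1 : 1 - dl < 1 by lra.
have [B B0 hB] := polybnd_abs_sum (polybnd_natmul pa) x0 x1.
exists (e / (B + 1)); first by apply: divr_gt0 => //; lra.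
move=> r r01; rewrite ltr_pdivlMr; last by lra.
move=> rB z z1; have rz1 := ray_disc z1 r01; have pr := polybnd_dilate r01 pa.
have -> : (psf (fun n => a n * r%:C ^+ n) - psf a) z =
  psf (fun n => a n * r%:C ^+ n) z - psf a z by [].
have w0 : 0 < 1 - cabs z by rewrite subr_gt0.
have [zx|xz] := leP (cabs z) (1 - dl).
  apply: (@le_trans _ _ (cabs (psf (fun n => a n * r%:C ^+ n) z - psf a z))).
    rewrite ler_piMl ?cabs_ge0//; have : (1 - cabs z) `^ mu <= (1 - cabs z) `^ 0.
      apply: ger_powR; last by apply: ltW; exact: lt_trans m01.
      by rewrite w0 lerBlDr lerDl cabs_ge0.
    by rewrite powRr0.
  apply: (@le_trans _ _ (B * (1 - r))); last first.
    case/andP: r01 => r0 r1; have := mulr_ge0 B0 (_ : 0 <= 1 - r); rewrite subr_ge0 => /(_ r1).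
    by lra.
  have h := csumD (psfP pr z1) (csumZ (-1) (psfP pa z1)); rewrite mulN1r in h.
  apply: csum_abs_le h => n; apply: (@le_trans _ _ ((\sum_(i < n) cabs (i%:R * a i) * (1 - dl) ^+ i) * (1 - r))).
    rewrite mulr_suml; apply: ler_sum => i _.
    have -> : a i * r%:C ^+ i * z ^+ i + -1 * (a i * z ^+ i) =
      a i * z ^+ i * (r ^+ i - 1)%:C by rewrite rmorphB rmorphXn rmorph1; ring.
    rewrite !cabsM cabsX cabs_nat cabs_real distrC.
    (* Bernoulli's inequality; the factor i is absorbed by the bound [B] on the series with
       coefficients [i%:R * a i]. *)
    have ri : `|1 - r ^+ i| <= i%:R * (1 - r).
      have hr : 0 <= 1 - r <= 1 by case/andP: r01 => r0 r1; apply/andP; split; lra.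
      have := bernoulli_sub i hr; have -> : 1 - (1 - r) = r by lra.
      move=> hb; rewrite ger0_norm; first lra.
      by rewrite subr_ge0; case/andP: r01 => r0 r1; exact: exprn_ile1.
    have -> : i%:R * cabs (a i) * (1 - dl) ^+ i * (1 - r) =
      cabs (a i) * (1 - dl) ^+ i * (i%:R * (1 - r)) by ring.
    apply: ler_pM => //; first by rewrite mulr_ge0 ?exprn_ge0 ?cabs_ge0.
    apply: ler_wpM2l; first exact: cabs_ge0.
    by rewrite lerXn2r ?nnegrE ?cabs_ge0.
  apply: ler_wpM2r; last exact: hB.
  by case/andP: r01 => r0 r1; rewrite subr_ge0.
rewrite psf_dilate//.
have wmu : (1 - cabs z) `^ mu = (1 - cabs z) `^ nu * (1 - cabs z) `^ mu0.
  rewrite -powRD; first by congr (_ `^ _); rewrite /nu; ring.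
  by rewrite (gt_eqF w0) implybT.
have p0 : 0 <= (1 - cabs z) `^ mu0 by exact: powR_ge0.
have q0 : 0 <= (1 - cabs z) `^ nu by exact: powR_ge0.
rewrite wmu -mulrA.
have h1 : (1 - cabs z) `^ mu0 * cabs (psf a (r%:C * z) - psf a z) <= 2 * L.
  apply: le_trans (ler_wpM2l p0 (cabsD _ _)) _; rewrite cabsN mulrDr.
  rewrite [2 * L]mulr_natl mulr2n; apply: lerD (fL z z1).
  apply: le_trans (fL _ rz1); apply: ler_wpM2r; first exact: cabs_ge0.
  have rz : cabs (r%:C * z) <= cabs z.
    by case/andP: r01 => r0 r1; rewrite cabsM cabs_real ger0_norm// ler_piMl// cabs_ge0.
  by apply: ge0_ler_powR; rewrite ?nnegrE ?subr_ge0 ?lerB ?(ltW nu0) ?(ltW mu00) ?(ltW z1) ?(ltW rz1).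
have h2 : (1 - cabs z) `^ nu <= y.
  apply: le_trans dly; apply: ge0_ler_powR; rewrite ?nnegrE; [exact: ltW|exact: ltW|exact: ltW|].
  by move: xz; clear; lra.
have L20 : 0 <= 2 * L by lra.
apply: le_trans (ler_wpM2l q0 h1) _; apply: le_trans (ler_wpM2r L20 h2) _.
by rewrite /y mulrAC ler_pdivrMr//; apply: ler_wpM2l; [exact: ltW|lra].
Qed.

End dilations.


(** * Closed J-invariant subspaces contain all functions of sufficient order *)

Section invariant_subspaces.
Variable R : realType.
Local Notation C := R[i].
Variables (s : korenblum_index R) (M : set (korenblum s)).
Hypotheses (M_lin : submod_closed (mem M)) (M_closed : closed M).
Hypothesis M_inv : Jfun (s := s) @` M `<=` M.

Local Notation E := (korenblum s).
Implicit Types f g : E.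

Let M0 : M 0.
Proof. by have [/set_mem] := M_lin. Qed.

Let MP (k : C) f g : M f -> M g -> M (k *: f + g).
Proof.
by move=> Mf Mg; have [_ /(_ k f g (mem_set Mf) (mem_set Mg)) /set_mem] := M_lin.
Qed.

Let MZ (k : C) f : M f -> M (k *: f).
Proof. by move=> Mf; have := MP k Mf M0; rewrite addr0. Qed.

Let M_sum N (F : nat -> E) : (forall j, M (F j)) -> M (\sum_(j < N) F j).
Proof.
move=> MF; elim: N => [|N ih]; first by rewrite big_ord0.
by rewrite big_ord_recr/= addrC -[F N]scale1r; exact: MP.
Qed.

Let M_iter k f : M f -> M (iter k (@Jfun R s) f).
Proof. by move=> Mf; elim: k => //= k Mk; apply: M_inv; exists (iter k (@Jfun R s) f). Qed.

Let telescope_tail (N n : nat) :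
  \sum_(m < n) (if (m < N.+2)%N then 0 else (m.-1%:R^-1 - m%:R^-1)) <= N.+1%:R^-1 :> R.
Proof.
have h : \sum_(m < n) (if (m < N.+2)%N then 0 else (m.-1%:R^-1 - m%:R^-1)) <=
    if (n < N.+2)%N then 0 else N.+1%:R^-1 - n.-1%:R^-1 :> R.
  elim: n => [|n ih]; first by rewrite big_ord0.
  rewrite big_ord_recr/=; have [nN|nN] := ltnP n N.+1.
    have n2 : (n < N.+2)%N by exact: ltnW.
    by rewrite n2 in ih; rewrite n2 ltnS nN addr0.
  have [n2|n2] := ltnP n N.+2.
    have nE : n = N.+1 by apply/eqP; rewrite eqn_leq -ltnS n2 nN.
    by move: ih; rewrite nE ltnSn ltnn addr0 /= subrr.
  have e1 : (n < N.+2)%N = false by rewrite ltnNge n2.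
  have e2 : (n.+1 < N.+2)%N = false by rewrite ltnNge (leqW n2).
  by rewrite e1 in ih; rewrite ?e1 e2 addrA lerD2r -lerBrDr.
apply: le_trans h _; case: ifP => _; first by rewrite invr_ge0.
by rewrite lerBlDr lerDl invr_ge0.
Qed.

(** A gain of two factorial steps bounds the m-th coefficient by D / (m (m-1)), whose tail
    telescopes to D / (N+1). *)
Lemma taylor_tail f N (D : R) : (forall m, (m < N.+2)%N -> taylor f m = 0) ->
  (forall m, (N.+2 <= m)%N -> cabs (taylor f m) <= D * (m - 2)`!%:R) ->
  forall z, cabs z < 1 -> cabs (val f z) <= D / N.+1%:R.
Proof.
move=> f0 fD z z1; have [a pa fE] := korenblum_taylor f.
have aE m : cabs (taylor f m) = m`!%:R * cabs (a m).
  by rewrite (taylor_psf m pa fE) cabsM cabs_nat.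
have fact0 m : 0 < (m`!%:R : R) by rewrite ltr0n fact_gt0.
have D0 : 0 <= D.
  have := fD N.+2 (leqnn _); rewrite -(pmulr_lge0 _ (fact0 (N.+2 - 2)%N)).
  by apply: le_trans; exact: cabs_ge0.
rewrite fE; apply: psf_bound => // n.
apply: (@le_trans _ _ (D * \sum_(m < n) (if (m < N.+2)%N then 0 else (m.-1%:R^-1 - m%:R^-1)))).
  rewrite mulr_sumr; apply: ler_sum => m _; case: ltnP => mN.
    have := aE m; rewrite f0// cabs0 => /esym/eqP; rewrite mulf_eq0 (gt_eqF (fact0 m))/=.
    by move=> /eqP ->; rewrite mulr0.
  have := fD m mN; rewrite aE; move: (nat_of_ord m) mN => {m} [|[|k]]// _.
  have -> : (k.+2 - 2 = k)%N by lia.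
  rewrite !factS !natrM => h.
  have h' : k.+2%:R * k.+1%:R * cabs (a k.+2) <= D.
    rewrite -(ler_pM2r (fact0 k)); apply: le_trans h.
    by rewrite le_eqVlt; apply/orP; left; apply/eqP; ring.
  have k1 : 0 < k.+1%:R :> R by rewrite ltr0n.
  have k2 : 0 < k.+2%:R :> R by rewrite ltr0n.
  have -> : D * (k.+2.-1%:R^-1 - k.+2%:R^-1) = D / (k.+2%:R * k.+1%:R).
    have kE : k.+2%:R = k.+1%:R + 1 :> R by rewrite natr1.
    rewrite /= kE; rewrite kE in k2; move: k1 k2.
    by move: (k.+1%:R : R) => t t0 t1; field; rewrite !gt_eqF.
  by rewrite ler_pdivlMr ?mulr_gt0// mulrC.
by apply: ler_wpM2l => //; exact: telescope_tail.
Qed.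

Lemma monomial_ex n : exists e : E, forall m, taylor e m = (m == n)%:R.
Proof.
pose a m : C := if m == n then (n`!%:R)^-1 else 0.
have f0 : (n`!%:R : C) != 0 by rewrite pnatr_eq0 -lt0n fact_gt0.
have aB N : \sum_(i < N) cabs (a i) <= cabs (n`!%:R^-1 : C).
  suff -> : \sum_(i < N) cabs (a i) = if (n < N)%N then cabs (n`!%:R^-1 : C) else 0.
    by case: ifP => // _; exact: cabs_ge0.
  elim: N => [|N ih]; first by rewrite big_ord0.
  rewrite big_ord_recr/= ih /a ltnS; case: ltngtP => [nN|nN|nN]; rewrite ?cabs0 ?addr0//.
    by rewrite add0r.
have [pa [e eE]] := korenblum_bounded s aB.
exists e => m; rewrite (taylor_psf m pa eE) /a; case: eqP => [->|_]; last by rewrite mulr0.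
by rewrite divff.
Qed.

Let sum_delta N (F : nat -> C) (m : nat) :
  \sum_(n < N) F n * (m == n :> nat)%:R = if (m < N)%N then F m else 0.
Proof.
elim: N => [|N ih]; first by rewrite big_ord0.
rewrite big_ord_recr/= ih ltnS; case: ltngtP => [mN|mN|mN]; rewrite ?mulr0 ?addr0//.
by rewrite add0r mulr1 mN.
Qed.

(** For r < 1 the Taylor polynomials of the dilation converge uniformly on the disc, and they
    involve only monomials of degree at least [n0]. *)
Lemma dilation_mem n0 g (a : nat -> C) (r : R) gr :
  (forall n e, (n0 <= n)%N -> (forall m, taylor e m = (m == n)%:R) -> M e) ->
  (forall m, (m < n0)%N -> taylor g m = 0) -> polybnd a -> val g = psf a ->
  0 <= r -> r < 1 -> val gr = psf (fun n => a n * r%:C ^+ n) -> M gr.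
Proof.
move=> Me g0 pa gE r0 r1 grE.
have r01 : 0 <= r <= 1 by rewrite r0 ltW.
have pr := polybnd_dilate r01 pa.
(* The factor m^2 provides the two factorial steps of [taylor_tail], since m! <= m^2 (m-2)!. *)
have [B B0 hB] := polybnd_abs_sum (polybnd_natmul (polybnd_natmul pa)) r0 r1.
have [e eE] := choice monomial_ex.
pose x N := \sum_(n < N.+2) (taylor g n * r%:C ^+ n) *: e n.
have tx N m : taylor (x N) m = if (m < N.+2)%N then taylor g m * r%:C ^+ m else 0.
  rewrite /x (taylor_sum N.+2 (fun n => (taylor g n * r%:C ^+ n) *: e n)).
  rewrite -(sum_delta N.+2 (fun n => taylor g n * r%:C ^+ n)); apply: eq_bigr => n _.
  by rewrite taylorZ eE.
have tgr m : taylor gr m = taylor g m * r%:C ^+ m.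
  by rewrite (taylor_psf m pr grE) (taylor_psf m pa gE) mulrA.
apply: (closed_uniform M_closed (x := x)) => [N|eps eps0].
  apply: (@M_sum N.+2 (fun n => (taylor g n * r%:C ^+ n) *: e n)) => n.
  have [nn0|n0n] := ltnP n n0; first by rewrite g0// mul0r scale0r.
  by apply: MZ; apply: (Me n).
have [N hN] := archi_div_le B eps0; exists N => n Nn z z1.
apply: le_trans (hN n Nn); apply: taylor_tail => // m mn.
  by rewrite taylorB tx mn tgr subrr.
rewrite taylorB tx ltnNge mn /= sub0r cabsN tgr (taylor_psf m pa gE).
have h : cabs (m%:R * (m%:R * a m)) * r ^+ m <= B.
  apply: le_trans (hB m.+1); rewrite big_ord_recr/= lerDr; apply: sumr_ge0 => i _.
  by rewrite mulr_ge0 ?cabs_ge0 ?exprn_ge0.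
rewrite !cabsM !cabs_nat in h; rewrite !cabsM cabs_nat cabsX cabs_real ger0_norm//.
have fk : 0 <= (m - 2)`!%:R :> R by [].
apply: le_trans (ler_wpM2r fk h).
have -> : m%:R * (m%:R * cabs (a m)) * r ^+ m * (m - 2)`!%:R =
  (m%:R * m%:R * (m - 2)`!%:R) * (cabs (a m) * r ^+ m) by ring.
rewrite -mulrA; apply: ler_wpM2r; first by rewrite mulr_ge0 ?cabs_ge0 ?exprn_ge0.
rewrite -!natrM ler_nat; case: m mn {h fk} => [|[|k]]// _.
have -> : (k.+2 - 2 = k)%N by lia.
by rewrite !factS mulnA; apply: leq_mul => //; apply: leq_mul.
Qed.

Lemma tail_mem n0 g :
  (forall n e, (n0 <= n)%N -> (forall m, taylor e m = (m == n)%:R) -> M e) ->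
  (forall m, (m < n0)%N -> taylor g m = 0) -> M g.
Proof.
move=> Me g0; have [a pa gE] := korenblum_taylor g.
pose r k : R := 1 - k.+2%:R^-1.
have kV k : 0 < (k.+2%:R^-1 : R) <= 1 / 2.
  by rewrite invr_gt0 ltr0n/= div1r lef_pV2 ?posrE ?ltr0n// ler_nat.
have r01 k : 0 <= r k /\ r k < 1 by rewrite /r; move: (kV k); move: (k.+2%:R^-1 : R) => v /andP[h1 h2]; split; lra.
have rr k : 0 <= r k <= 1 by case: (r01 k) => -> /ltW.
have dil k : exists gr : E, val gr = psf (fun n => a n * (r k)%:C ^+ n).
  have [r0 r1] := r01 k; have [B _ hB] := polybnd_abs_sum pa r0 r1.
  have aB n : \sum_(i < n) cabs (a i * (r k)%:C ^+ i) <= B.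
    apply: le_trans (hB n); apply: ler_sum => i _.
    by rewrite cabsM cabsX cabs_real ger0_norm.
  by have [] := @korenblum_bounded R s (fun i => a i * (r k)%:C ^+ i) B aB.
have [x xE] := choice dil.
apply: (closed_growth M_closed (x := x)) => [k|mu0 mu mu00 m01 gmu e e0].
  by have [r0 r1] := r01 k; exact: (dilation_mem Me g0 pa gE r0 r1 (xE k)).
move: gmu => /growth_spaceP[_ [L gL]]; rewrite gE in gL.
have [d d0 hd] := dilation_growth pa mu00 m01 gL e0.
have d2 : 0 < d / 2 by rewrite divr_gt0.
(* It is used at [k.+1], because 1 - r_k = 1/(k+2). *)
have [N hN] := archi_div_le 1 d2; exists N => k Nk; rewrite xE gE.
apply: hd; first exact: rr.
rewrite /r opprB addrC subrK; have := hN k.+1 (leqW Nk); rewrite div1r => h.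
by apply: le_lt_trans h _; lra.
Qed.

(* With [1 / b = c_0 + c_1 x + ...], the polynomial [c_0 + ... + c_N x^N] in [J]
   maps [J^L f] to [z^(K+L)/(K+L)!] up to terms of degree above [K+L+N]; the
   margin [L = q+2] makes their coefficients summable. *)
Lemma monomial_mem f K : M f -> (forall m, (m < K)%N -> taylor f m = 0) -> taylor f K != 0 ->
  exists2 n0, (K <= n0)%N &
    forall n e, (n0 <= n)%N -> (forall m, taylor e m = (m == n)%:R) -> M e.
Proof.
move=> Mf f0 fK; pose b n := taylor f (n + K)%N.
have b0 : b 0%N != 0 by rewrite /b add0n.
have [p [B [B0 hB]]] := taylor_bound f.
have bB n : cabs (b n) <= B * (n + (K + p))`!%:R by rewrite addnA; exact: hB.
have [c cE] := reciprocal_ex b0.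
have [q [D [D0 hD]]] := reciprocal_bound b0 B0 bB cE.
pose L := q.+2; pose x N := \sum_(j < N.+1) c j *: iter (j + L) (@Jfun R s) f.
have Mx N : M (x N).
  by apply: (@M_sum N.+1 (fun j => c j *: iter (j + L) (@Jfun R s) f)) => j; exact/MZ/M_iter.
have tx0 N m : (m < K + L)%N -> taylor (x N) m = 0.
  move=> mKL; rewrite (taylor_sum N.+1 (fun j => c j *: iter (j + L) (@Jfun R s) f)) big1// => j _; rewrite taylorZ taylor_iterJ.
  case: ltnP => mj; first by rewrite mulr0.
  by rewrite f0 ?mulr0//; lia.
have tx N n : taylor (x N) (K + L + n) =
    \sum_(j < N.+1) if (j <= n)%N then c j * b (n - j)%N else 0.
  rewrite (taylor_sum N.+1 (fun j => c j *: iter (j + L) (@Jfun R s) f)).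
  apply: eq_bigr => j _; rewrite taylorZ taylor_iterJ.
  case: (leqP j n) => jn.
    rewrite ifF; last by apply/negbTE; rewrite -leqNgt; lia.
    by congr (_ * taylor f _); lia.
  case: ltnP => mj; first by rewrite mulr0.
  by rewrite f0 ?mulr0//; lia.
have tx_le N n : (n <= N)%N -> taylor (x N) (K + L + n) = (n == 0%N)%:R.
  move=> nN; rewrite tx -cE (big_ord_widen N.+1 (fun j => c j * b (n - j)%N)) ?ltnS//.
  by rewrite [RHS]big_mkcond; apply: eq_bigr => j _; rewrite ltnS.
have tx_gt N n : (N < n)%N -> cabs (taylor (x N) (K + L + n)) <= D * (n + q)`!%:R.
  move=> Nn; rewrite tx; apply: le_trans (cabs_sum _ _ _) _; apply: le_trans (hD n).
  rewrite (big_ord_widen_cond n.+1 xpredT (fun j => cabs (if (j <= n)%N then c j * b (n - j)%N else 0))).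
    rewrite big_mkcond/=; apply: ler_sum => j _; case: ifP => _.
      by rewrite -ltnS ltn_ord cabsM.
    by rewrite mulr_ge0 ?cabs_ge0.
  by lia.
have [y yE] := monomial_ex (K + L).
have eqKL k : (K + L + k == K + L)%N = (k == 0%N) by rewrite -[X in _ == X]addn0 eqn_add2l.
have My : M y.
  apply: (closed_uniform M_closed Mx) => e e0; have [N hN] := archi_div_le D e0.
  exists N => n Nn z z1; apply: le_trans (hN n Nn).
  have td m : (m < n.+2)%N -> taylor (x n - y) m = 0.
    move=> mn; rewrite taylorB yE; have [mKL|KLm] := ltnP m (K + L).
      by rewrite tx0// ltn_eqF// subrr.
    have [k mE] : exists k, m = (K + L + k)%N by exists (m - (K + L))%N; rewrite subnKC.
    by rewrite mE eqKL tx_le ?subrr//; move: mn; rewrite mE /L; lia.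
  apply: taylor_tail => // m mn; rewrite taylorB yE; have [mKL|KLm] := ltnP m (K + L).
    by rewrite tx0// ltn_eqF// subrr cabs0 mulr_ge0.
  have [k mE] : exists k, m = (K + L + k)%N by exists (m - (K + L))%N; rewrite subnKC.
  rewrite mE eqKL; have [kn|nk] := leqP k n.
    by rewrite tx_le// subrr cabs0 mulr_ge0.
  rewrite gtn_eqF; last by lia.
  rewrite subr0; apply: le_trans (tx_gt n k nk) _; apply: ler_wpM2l => //.
  by rewrite ler_nat; apply: leq_fact; rewrite /L; lia.
exists (K + L)%N; first exact: leq_addr.
(* One normalized monomial suffices: J sends z^n/n! to the next one. *)
move=> n e KLn en; have -> : e = iter (n - (K + L)) (@Jfun R s) y; last exact: M_iter.
apply: taylor_inj => m; rewrite en taylor_iterJ yE.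
case: ltnP => mn.
  by rewrite ltn_eqF//; lia.
by congr (nat_of_bool _)%:R; apply/eqP/eqP; lia.
Qed.

Lemma order_mem f K : M f -> (forall m, (m < K)%N -> taylor f m = 0) -> taylor f K != 0 ->
  forall g, (forall m, (m < K)%N -> taylor g m = 0) -> M g.
Proof.
move=> Mf f0 fK; have [n0 Kn0 Me] := monomial_mem Mf f0 fK.
(* Here [d] counts the orders already regained below [n0]. *)
suff h d : (d <= n0 - K)%N -> forall g, (forall m, (m < n0 - d)%N -> taylor g m = 0) -> M g.
  by move=> g g0; apply: (h (n0 - K)%N) => // m; rewrite subKn//; exact: g0.
elim: d => [|d ih] dK g g0; first by rewrite subn0 in g0; exact: tail_mem Me g0.
set n := (n0 - d.+1)%N in g0; pose u := iter (n - K) (@Jfun R s) f.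
have nK : (K <= n)%N by rewrite /n; lia.
have u0 m : (m < n)%N -> taylor u m = 0.
  by move=> mn; rewrite taylor_iterJ; case: ltnP => // h; rewrite f0//; lia.
have un : taylor u n = taylor f K.
  by rewrite taylor_iterJ ltnNge leq_subr/= subKn.
have -> : g = (taylor g n / taylor f K) *: u + (g - (taylor g n / taylor f K) *: u).
  by rewrite addrC subrK.
apply: MP; first exact: M_iter.
apply: ih; first by lia.
move=> m mn; rewrite taylorB taylorZ; have [mn'|nm] := ltnP m n.
  by rewrite g0// u0// mulr0 subrr.
have -> : m = n by rewrite /n in nm *; lia.
by rewrite un divfK// subrr.
Qed.

End invariant_subspaces.
Theorem corollary4p2 (R : realType) (s : korenblum_index R) :
  exists J : {linear korenblum s -> korenblum s},
    [/\ forall f : korenblum s, val (J f) = integration (val f),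
        continuous J &
        forall M : set (korenblum s),
          submod_closed (mem M) -> closed M ->
          M <> [set 0] -> M <> setT -> J @` M `<=` M ->
          exists2 K : nat, (0 < K)%N &
            M = [set f | forall j : nat, (j < K)%N ->
                           derive1n j (val f) 0 = 0]].
Proof.
exists (@Jfun R s); split; [exact: val_Jfun|exact: Jfun_continuous|].
move=> M M_lin M_closed M_ne0 M_neT M_inv.
have M0 : M 0 by have [/set_mem] := M_lin.
have [f [Mf [n fn]]] : exists f, M f /\ exists n, taylor f n != 0.
  apply: contrapT => nof; apply: M_ne0; apply/seteqP; split=> [f Mf|_ ->//].
  apply: taylor_inj => n; rewrite taylor0; apply/eqP/negPn/negP => fn.
  by apply: nof; exists f; split=> //; exists n.
(* The least such k serves twice: its witness has order exactly K, and every element of M vanishes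
   to order K. *)
pose P k := `[< exists g, M g /\ taylor g k != 0 >].
have exP : exists k, P k by exists n; apply/asboolP; exists f.
case: (ex_minnP exP) => K /asboolP[g [Mg gK]] K_min.
have M_order h m : M h -> (m < K)%N -> taylor h m = 0.
  move=> Mh mK; apply/eqP/negPn/negP => hm.
  have : (K <= m)%N by apply: K_min; apply/asboolP; exists h.
  by rewrite leqNgt mK.
have all_mem := order_mem M_lin M_closed M_inv Mg (fun m => M_order g m Mg) gK.
exists K.
  (* If K were 0, the vanishing condition would be empty and M the whole space. *)
  rewrite lt0n; apply/eqP => K0; apply: M_neT; apply/seteqP; split=> // h _.
  by apply: all_mem => m; rewrite K0.
apply/seteqP; split=> [h Mh m mK|h hK]; first exact: (M_order h m Mh mK).
exact: all_mem.
Qed.
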